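(* Let $\phi:[0,\infty)\to[0,\infty)$, $F,F_1:(0,\infty)\times\mathbb{R}\to(0,\infty)$, let $p,q\in\mathcal{P}(\mathbb{R})$ satisfy $1/p(x)+1/q(x)=1$, and let $(R(t))_{t>0}\subseteq L(X,Y)$ be a strongly continuous operator family. Let $g:\mathbb{R}\to X$ be such that $\check g$ is measurable and $\int_{-x}^\infty\|R(v+x)\|\,\|\check g(v)\|\,dv<\infty$ for every $x\in\mathbb{R}$. For $l,\epsilon>0$ and $x\in\mathbb{R}$ put $$\Sigma(l,\epsilon,x):=\sum_{k=0}^\infty\bigl\|R(v+x)\bigr\|_{L^{q(v)}[-x+kl,-x+(k+1)l]}\,\sup\phi^{-1}\Bigl(\bigl[0,\epsilon F(l,-x+kl)^{-1}\bigr]\Bigr),$$ and suppose $\Sigma(l,\epsilon,x)<\infty$ for all $l,\epsilon>0$, $x\in\mathbb{R}$. For $t\in\mathbb{R}$ and $l,\epsilon>0$ consider the condition $( * )$ there exist $a>0$ and $\lambda>0$ such that $\lambda\le a$, $[0,a]\subseteq\phi^{-1}\bigl([0,\epsilon F_1(l,t)^{-1}]\bigr)$ and $$\int_t^{t+l}\varphi_{p(x)}\Bigl(\frac{2\,\Sigma(l,\epsilon,x)}{\lambda}\Bigr)\,dx\le1 .$$ (a) If $\check g$ is equi-Weyl-$(p,\phi,F)_1$-almost periodic and $( * )$ holds for every $t\in\mathbb{R}$ and $l,\epsilon>0$, then $G:\mathbb{R}\to Y$, $G(x):=\int_{-\infty}^xR(x-s)g(s)\,ds$, is well-defined and equi-Weyl-$(p,\phi,F_1)_1$-almost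 periodic. (b) If $\check g$ is Weyl-$(p,\phi,F)_1$-almost periodic and there exists $l_0>0$ such that $( * )$ holds for all $l\ge l_0$, $\epsilon>0$ and $t\in\mathbb{R}$, then $G$ is well-defined and Weyl-$(p,\phi,F_1)_1$-almost periodic.
   Context: $X,Y$ are complex Banach spaces; $L(X,Y)$ is the space of bounded linear operators from $X$ to $Y$; $\check g(t):=g(-t)$; $\phi^{-1}(A)$ denotes the preimage of $A$ under $\phi$. For $\Omega\subseteq\mathbb{R}$, $\mathcal{P}(\Omega)$ is the set of Lebesgue measurable $p:\Omega\to[1,\infty]$ (with $1/\infty=0$). For $t\ge 0$: $\varphi_{p(x)}(t)=t^{p(x)}$ if $p(x)<\infty$; if $p(x)=\infty$, $\varphi_{p(x)}(t)=0$ for $0\le t\le 1$ and $\varphi_{p(x)}(t)=\infty$ for $t>1$. A measurable $u$ on $\Omega$ belongs to $L^{p(x)}(\Omega)$ iff $\int_\Omega\varphi_{p(x)}(\lambda\|u(x)\|)dx<\infty$ for some $\lambda>0$, and $\|u\|_{L^{p(\cdot)}(\Omega)}=\inf\{\lambda>0:\int_\Omega\varphi_{p(x)}(\|u(x)\|/\lambda)\,dx\le 1\}$. On subintervals the restriction of $p$ is used; in $\|R(v+x)\|_{L^{q(v)}[a,b]}$ the variable is $v$ and the $L^{q(v)}$-norm of the operator norm $v\mapsto\|R(v+x)\|_{L(X,Y)}$ is meant. Let $p\in\mathcal{P}(\mathbb{R})$, $\phi:[0,\infty)\to[0,\infty)$, $F:(0,\infty)\times\mathbb{R}\to(0,\infty)$,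 let $Z$ be a Banach space, and let $f:\mathbb{R}\to Z$ be such that $\|f(\cdot+\tau)-f(\cdot)\|\in L^{p(x)}(K)$ for every $\tau\in\mathbb{R}$ and compact $K\subseteq\mathbb{R}$. Then $f$ is: - equi-Weyl-$(p,\phi,F)_1$-almost periodic iff for each $\epsilon>0$ there are $l>0$, $L>0$ such that every interval $I'\subseteq\mathbb{R}$ of length $L$ contains $\tau$ with $\sup_{t\in\mathbb{R}}F(l,t)\,\phi\bigl(\|f(\cdot+\tau)-f(\cdot)\|_{L^{p(\cdot)}[t,t+l]}\bigr)\le\epsilon$; - Weyl-$(p,\phi,F)_1$-almost periodic iff for each $\epsilon>0$ there is $L>0$ such that every interval $I'\subseteq\mathbb{R}$ of length $L$ contains $\tau$ with $\limsup_{l\to\infty}\sup_{t\in\mathbb{R}}F(l,t)\,\phi\bigl(\|f(\cdot+\tau)-f(\cdot)\|_{L^{p(\cdot)}[t,t+l]}\bigr)\le\epsilon$.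
   Formalization: For G, membership of ‖G(·+τ)−G(·)‖ in L^{p(x)}(K) for compact K is claimed only for the almost periods τ, not for every real τ as the definition presupposes; for every τ the claim fails in general (unbounded p, periodic ǧ with a one-sided log singularity). *)

(* Defs.v *)
From HB Require Import structures.
From mathcomp Require Import all_boot all_order all_algebra.
From mathcomp Require Import all_classical all_reals all_analysis.
From mathcomp Require Import measurable_realfun.
From mathcomp Require Export complex.

Set Implicit Arguments.
Unset Strict Implicit.
Unset Printing Implicit Defensive.

Import Order.TTheory GRing.Theory Num.Theory.
Import numFieldNormedType.Exports.

Local Open Scope classical_set_scope.
Local Open Scope ring_scope.

(* The norm of a normed module over R[i] takes its values in R[i]; [rnorm] is
   the same (real) number, seen in R. *)
Definition rnorm (R : realType) (V : normedModType R[i]) (v : V) : R :=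
  complex.Re `|v|.

Definition opnorm (R : realType) (X Y : normedModType R[i]) (T : X -> Y) : R :=
  sup [set rnorm (T v) | v in [set v : X | rnorm v <= 1]].

(* The real line with the sigma-algebra of Lebesgue (not only Borel) measurable
   sets, on which [completed_lebesgue_measure] is defined. *)
Notation lebesgueType R := (caratheodory_type ((@wlength R idfun)^*)%mu).

Definition lebesgue (R : realType) : {measure set (lebesgueType R) -> \bar R} :=
  @completed_lebesgue_measure R.

Section bochner.
Local Open Scope ereal_scope.
Context d (T : measurableType d) (R : realType).
Variables (mu : {measure set T -> \bar R}) (D : set T).
Variable V : normedModType R[i].

Definition vsimple (s : T -> V) : Prop :=
  finite_set (range s) /\ forall y, measurable (s @^-1` [set y]).

Definition vsimple_integrable (s : T -> V) : Prop :=
  vsimple s /\ forall y, y <> 0%R -> mu (D `&` s @^-1` [set y]) < +oo.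

Definition vsimple_integral (s : T -> V) : V :=
  (\sum_(y \in range s) (fine (mu (D `&` s @^-1` [set y])))%:C%C *: y)%R.

Definition strongly_measurable (f : T -> V) : Prop :=
  exists s : nat -> T -> V, (forall n, vsimple (s n)) /\
    {ae mu, forall x, D x -> s n x @[n --> \oo] --> f x}.

Definition is_bochner_integral (f : T -> V) (y : V) : Prop :=
  exists s : nat -> T -> V,
    [/\ forall n, vsimple_integrable (s n),
        {ae mu, forall x, D x -> s n x @[n --> \oo] --> f x},
        \int[mu]_(x in D) (rnorm (f x - s n x)%R)%:E @[n --> \oo] --> 0 &
        vsimple_integral (s n) @[n --> \oo] --> y].

Definition bochner_integrable (f : T -> V) : Prop :=
  exists y, is_bochner_integral f y.

(* 0 if f is not Bochner integrable *)
Definition bochner_integral (f : T -> V) : V :=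
  xget 0%R [set y | is_bochner_integral f y].

End bochner.

Section variable_exponent.
Local Open Scope ereal_scope.
Variable R : realType.
Implicit Types (p : lebesgueType R -> \bar R) (u : lebesgueType R -> R).

Definition exponent p : Prop :=
  measurable_fun setT p /\ forall x, 1 <= p x.

(* only used for 1 <= r and 0 <= t *)
Definition varphi (r : \bar R) (t : R) : \bar R :=
  match r with
  | s%:E => (t `^ s)%:E
  | +oo => if (t <= 1)%R then 0 else +oo
  | -oo => 0
  end.

Definition modular p (A : set (lebesgueType R)) u : \bar R :=
  \int[@lebesgue R]_(x in A) varphi (p x) (u x).

(* u stands for a norm function x |-> ||u(x)|| *)
Definition inLp p (A : set (lebesgueType R)) u : Prop :=
  measurable_fun A u /\
  exists2 lam : R, (0 < lam)%R & modular p A (fun x => lam * u x)%R < +oo.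

(* equal to +oo if no lambda qualifies *)
Definition Lpnorm p (A : set (lebesgueType R)) u : \bar R :=
  ereal_inf [set lam%:E | lam in
    [set lam : R | (0 < lam)%R /\ modular p A (fun x => u x / lam)%R <= 1]].

End variable_exponent.

Section weyl.
Variables (R : realType) (Z : completeNormedModType R[i]).
Variables (p : lebesgueType R -> \bar R) (phi : R -> R) (F : R -> R -> R).
Implicit Types (f : R -> Z) (tau l : R).

Definition transl_diff f tau : lebesgueType R -> R :=
  fun x => rnorm (f (x + tau) - f x).

Definition transl_diff_Lp_loc f tau : Prop :=
  forall K : set R, compact K -> inLp p K (transl_diff f tau).

Definition weyl_sup f tau l : \bar R :=
  ereal_sup (range (fun t : R =>
    (F l t * phi (fine (Lpnorm p `[t, t + l] (transl_diff f tau))))%:E)).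

(* every interval (open, closed or half-open) of length L meets P *)
Definition meets_intervals (L : R) (P : set R) : Prop :=
  forall (a : R) (b1 b2 : bool),
    exists2 tau, tau \in Interval (BSide b1 a) (BSide b2 (a + L)) & P tau.

(* In both definitions the local integrability of ||f(. + tau) - f|| is required
   of the almost periods tau only: this is what makes the seminorm finite, hence
   [phi] of it meaningful. If it is assumed for all tau, the first conjunct
   is redundant. *)
Definition equi_weyl_ap f : Prop :=
  forall eps : R, 0 < eps ->
    exists l L : R, [/\ 0 < l, 0 < L & meets_intervals L
      [set tau | transl_diff_Lp_loc f tau /\
                 (weyl_sup f tau l <= eps%:E)%E]].

Definition weyl_ap f : Prop :=
  forall eps : R, 0 < eps ->
    exists2 L : R, 0 < L & meets_intervals L
      [set tau | transl_diff_Lp_loc f tau /\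
                 (limf_esup (weyl_sup f tau) (+oo_R) <= eps%:E)%E].

End weyl.

Section convolution.
Variables (R : realType) (X Y : completeNormedModType R[i]).
Variables (T : R -> {linear X -> Y}) (p q : lebesgueType R -> \bar R).
Variables (phi : R -> R) (F F1 : R -> R -> R).

Definition check (g : R -> X) : R -> X := fun t => g (- t).

(* the integral over (-oo, x) of T (x - s) (g s) *)
Definition convol_integrand (g : R -> X) (x : R) : lebesgueType R -> Y :=
  fun s => T (x - s) (g s).

Definition convol (g : R -> X) (x : R) : Y :=
  bochner_integral (@lebesgue R) `]-oo, x[ (convol_integrand g x).

(* the preimage of [0, c] under phi : [0, +oo) -> [0, +oo) *)
Definition phi_preimage (c : R) : set R :=
  [set s | 0 <= s /\ 0 <= phi s <= c].

Definition node (l x : R) (k : nat) : R := - x + k%:R * l.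

Definition Sigma (l eps x : R) : \bar R :=
  (\sum_(0 <= k <oo)
    (Lpnorm q `[node l x k, node l x k.+1] (fun v : R => opnorm (T (v + x)%R))
     * ereal_sup (EFin @` phi_preimage (eps * (F l (node l x k))^-1)%R)))%E.

Definition star (t l eps : R) : Prop :=
  exists a lam : R,
    [/\ 0 < a, 0 < lam, lam <= a,
        `[0, a] `<=` phi_preimage (eps * (F1 l t)^-1) &
        (modular p `[t, (t + l)%R]
           (fun x : R => 2 * fine (Sigma l eps x) / lam)%R <= 1)%E].

End convolution.

(* Main.v *)
From HB Require Import structures.
Require Import Defs.
From mathcomp Require Import all_boot all_order all_algebra.
From mathcomp Require Import all_classical all_reals all_analysis.
From mathcomp Require Import measurable_realfun finmap ring lra.
Set Implicit Arguments.
Unset Strict Implicit.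
Unset Printing Implicit Defensive.
Import Order.TTheory GRing.Theory Num.Theory.
Import numFieldNormedType.Exports.
Local Open Scope classical_set_scope.
Local Open Scope ring_scope.

(** Write [w := check g].  The substitution [s = - v] turns the convolution into
the integral of [T (v + x) (w v)] over [v > - x], and the substitution
[s = - tau - v] turns its value at [x - tau] into the integral of
[T (v + x) (w (v + tau))] over the same half-line.  So an almost period [tau] of
[w] controls the translation of [G := convol T g] by [- tau]:
the distance of [G (x - tau)] and [G x] is at most the integral over [v > - x]
of the product of [opnorm (T (v + x))] and [transl_diff w tau v]
([convol_diff_le]).  Cut the half-line into the cells that start at the points
[node l x k] and have length [l].  On a cell the Hoelder inequality for the
conjugate exponents [p x], [q x] holds with the constant 2, and the hypothesis on
[tau] puts the L^p norm of [transl_diff w tau] into the preimage under [phi] that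
occurs in the [k]-th term of [Sigma].  Summation gives the bound
[2 * Sigma l eps x] ([convol_diff_le_Sigma]).  Condition [star] is made for this
bound: it says that a function below it has norm at most [lam <= a] on
[[t, t + l]], where [phi] is at most [eps / F1 l t] on [[0, a]]
([star_weyl_sup]).  The same [l] serves [tau] and [- tau], which proves the
equi-Weyl case at once; in the Weyl case the hypothesis is used with [eps / 2],
because the upper limit only bounds all large [l] with a loss.

The analytic work is to show that [G] exists and that the function [x |-> rnorm (G
(x + tau) - G x)] is measurable, as membership in L^p demands. Both come from one
construction ([convolution_lipschitz_approx]). Approximate [w] by simple functions
dominated by [2 * rnorm w], cut the kernel off to [[1/(n+1), 1/(n+1) + n+1[] and
replace it there by a step function on a grid so fine that, applied to the
finitely many values of the [n]-th simple function, it changes by at most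
[1/(n+1)^2]. By dominated convergence the resulting integrals [J n x] converge for
every [x], which is existence. Moreover [J n x] is a combination of fixed vectors
with coefficients [mu ([p - x, q - x[ `&` A)]; these are Lipschitz in [x], so [G]
is a pointwise limit of continuous functions.

The Bochner integral is developed as far as this needs: the norm estimate
[bochner_dist], from which uniqueness follows, the invariance under a
measure-preserving involution ([is_bochner_involution]), which yields both
substitutions above, and existence from approximation in mean
([is_bochner_cvg]). *)

(** * Real-valued norms of complex normed spaces *)

Section rnorm.
Context {R : realType} {V : normedModType R[i]}.
Implicit Types (u v w : V) (a : R).

Lemma rnormE v : `|v| = (rnorm v)%:C%C.
Proof. by rewrite RRe_real// normr_real. Qed.

Lemma rnorm_ge0 v : 0 <= rnorm v.
Proof. by rewrite -lecR -rnormE normr_ge0. Qed.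

Lemma rnorm0 : rnorm (0 : V) = 0.
Proof. by rewrite /rnorm normr0. Qed.

Lemma rnorm_eq0 v : (rnorm v == 0) = (v == 0).
Proof.
by rewrite -[v == 0]normr_eq0 rnormE; apply/idP/idP => [/eqP->//|/eqP[->]].
Qed.

Lemma rnormN v : rnorm (- v) = rnorm v.
Proof. by rewrite /rnorm normrN. Qed.

Lemma rnormBC u v : rnorm (u - v) = rnorm (v - u).
Proof. by rewrite -rnormN opprB. Qed.

Lemma rnormD u v : rnorm (u + v) <= rnorm u + rnorm v.
Proof. by rewrite -lecR rmorphD/= -!rnormE ler_normD. Qed.

Lemma rnorm_dist_triangle w u v : rnorm (u - v) <= rnorm (u - w) + rnorm (w - v).
Proof. by rewrite (le_trans _ (rnormD _ _))// addrA subrK. Qed.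

Lemma rnormB_le u v : rnorm u - rnorm v <= rnorm (u - v).
Proof. by rewrite lerBlDr (le_trans _ (rnormD _ _))// subrK. Qed.

Lemma rnormB_dist u v : `|rnorm u - rnorm v| <= rnorm (u - v).
Proof.
by rewrite ler_norml rnormB_le andbT lerNl opprB rnormBC rnormB_le.
Qed.

Lemma rnormZ a v : rnorm (a%:C%C *: v) = `|a| * rnorm v.
Proof.
apply: (@complexI R); rewrite rmorphM/= -!rnormE normrZ; congr (_ * _).
by rewrite normc_def /= expr0n/= addr0 sqrtr_sqr.
Qed.

Lemma rnorm_sum (I : Type) (r : seq I) (P : pred I) (F : I -> V) :
  rnorm (\sum_(i <- r | P i) F i) <= \sum_(i <- r | P i) rnorm (F i).
Proof.
elim/big_rec2: _ => [|i x y _ xy]; first by rewrite rnorm0.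
by rewrite (le_trans (rnormD _ _))// lerD2l.
Qed.

Lemma cvg_rnormP (S : Type) (F : set_system S) (FF : Filter F) (f : S -> V) v :
  f x @[x --> F] --> v <-> (rnorm (f x - v) : R) @[x --> F] --> (0 : R).
Proof.
split=> [/cvgrPdist_lt fv|/cvgrPdist_lt fv]; apply/cvgrPdist_lt => e e0.
  near=> x; rewrite sub0r normrN ger0_norm ?rnorm_ge0//.
  rewrite -ltcR -rnormE distrC; near: x; apply: fv.
  by rewrite ltcR.
have er : e = (complex.Re e)%:C%C by rewrite RRe_real// gtr0_real.
have e0' : 0 < complex.Re e by rewrite -ltcR -er.
near=> x; rewrite distrC rnormE er ltcR.
rewrite -[X in X < _]ger0_norm ?rnorm_ge0// -normrN -sub0r.
by near: x; apply: fv.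
Unshelve. all: by end_near. Qed.

Lemma cvg_rnorm (S : Type) (F : set_system S) (FF : Filter F) (f : S -> V) v :
  f x @[x --> F] --> v -> (rnorm (f x) : R) @[x --> F] --> (rnorm v : R).
Proof.
move=> /cvg_rnormP/cvgrPdist_lt fv; apply/cvgrPdist_lt => e e0.
near=> x; apply: (le_lt_trans (rnormB_dist _ _)); rewrite rnormBC.
rewrite -[X in X < _]ger0_norm ?rnorm_ge0// -normrN -sub0r.
by near: x; apply: fv.
Unshelve. all: by end_near. Qed.

End rnorm.

Lemma cauchy_rnorm_cvg (R : realType) (V : completeNormedModType R[i])
    (u : nat -> V) :
  (forall e : R, 0 < e ->
    exists N, forall m n, (N <= m)%N -> (N <= n)%N -> rnorm (u m - u n) < e) ->
  exists v : V, u n @[n --> \oo] --> v.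
Proof.
move=> uC; have : cvg (u n @[n --> \oo]); last first.
  by move=> /cvg_ex.
apply: cauchy_cvg; apply/cauchy_ballP => e e0.
have er : e = (complex.Re e)%:C%C by rewrite RRe_real// gtr0_real.
have /uC[N uN] : 0 < complex.Re e by rewrite -ltcR -er.
exists (u @` [set n | (N <= n)%N], u @` [set n | (N <= n)%N]).
  by split; exists N => // n /= Nn; exists n.
move=> [x y]/= [[m Nm <-] [n Nn <-]].
by rewrite -ball_normE/= rnormE er ltcR; exact: uN.
Qed.

Section opnorm.
Context {R : realType} {X Y : normedModType R[i]}.
Implicit Types (T : {linear X -> Y}).

Lemma opnorm_has_sup T : bounded_near T (nbhs (0 : X)) ->
  has_sup [set rnorm (T v) | v in [set v : X | rnorm v <= 1]].
Proof.
move=> /linear_boundedP[M [Mr TM]].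
split; first by exists (rnorm (T 0)), 0 => //=; rewrite rnorm0.
have Mr' : M = (complex.Re M)%:C%C by rewrite RRe_real.
exists (`|complex.Re M| + 1) => _ [v /= v1 <-].
have : M < (`|complex.Re M| + 1)%:C%C.
  by rewrite Mr' ltcR (le_lt_trans (ler_norm _))// ltrDl.
move=> /TM/(_ v); rewrite !rnormE -rmorphM/= lecR => /le_trans; apply.
by rewrite ler_piMr// addr_ge0.
Qed.

Lemma opnorm_ge0 T : 0 <= opnorm T.
Proof.
rewrite /opnorm; set S := (S in sup S).
have [hS|nS] := pselect (has_sup S); last by rewrite sup_out.
by apply: ub_le_sup; [case: hS|exists 0; rewrite /= ?linear0 ?rnorm0].
Qed.

Lemma opnorm_le T v : bounded_near T (nbhs (0 : X)) ->
  rnorm (T v) <= opnorm T * rnorm v.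
Proof.
move=> bT; have [->|v0] := eqVneq v 0; first by rewrite linear0 !rnorm0 mulr0.
have nv0 : 0 < rnorm v by rewrite lt_neqAle rnorm_ge0 eq_sym rnorm_eq0 v0.
rewrite -ler_pdivrMr// mulrC -[(rnorm v)^-1]ger0_norm ?invr_ge0 ?rnorm_ge0//.
rewrite -rnormZ -linearZ; apply: ub_le_sup.
  by have [] := opnorm_has_sup bT.
exists ((rnorm v)^-1%:C%C *: v) => //=.
by rewrite rnormZ ger0_norm ?invr_ge0 ?rnorm_ge0// mulVf// gt_eqF.
Qed.

End opnorm.

Lemma lipschitz_dist_continuous (R : realType) (Y : normedModType R[i])
    (u : R -> Y) (tau C : R) :
  (forall x x', rnorm (u x - u x') <= C * `|x - x'|) ->
  continuous (fun x : R => rnorm (u (x + tau) - u x)).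
Proof.
move=> uC x; apply: cvg_rnorm.
have cu z : u s @[s --> z] --> u z.
  apply/cvg_rnormP.
  apply: (@squeeze_cvgr _ _ _ _ (cst 0) (fun s => C * `|s - z|)).
  - by apply: nearW => s; rewrite rnorm_ge0/=.
  - exact: cvg_cst.
  - rewrite -[X in _ --> X](mulr0 C); apply: cvgM; first exact: cvg_cst.
    rewrite -[X in _ --> X](_ : `|z - z| = 0); last by rewrite subrr normr0.
    apply: cvg_norm.
    by apply: (@cvgB _ R); [exact: cvg_id|exact: cvg_cst].
apply: cvgB; last exact: cu.
apply: (@cvg_comp _ _ _ (fun s : R => s + tau) u _ (nbhs (x + tau))); last exact: cu.
by apply: (@cvgD _ R); [exact: cvg_id|exact: cvg_cst].
Qed.

(** * Lebesgue measure: reflections and translates *)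

Section lebesgue.
Context {R : realType}.
Notation LT := (lebesgueType R).
Notation mu := (@lebesgue R).
Local Open Scope ereal_scope.

Lemma borel_lebesgue (A : set R) : measurable A -> measurable (A : set LT).
Proof. exact: (@sub_caratheodory _ (ocitv_type R) R (wlength idfun)). Qed.

Lemma lebesgue_itv (i : interval R) : measurable ([set` i] : set LT).
Proof. exact/borel_lebesgue. Qed.

Lemma lebesgueE (A : set R) : mu A = lebesgue_measure A.
Proof. by []. Qed.

Lemma lebesgue_complete : measure_is_complete mu.
Proof. exact: completed_lebesgue_measure_is_complete. Qed.

Lemma measurable_fun_borel d (S : measurableType d) (D : set R)
    (f : measurableTypeR R -> S) :
  measurable (D : set R) -> measurable_fun D f -> measurable_fun (D : set LT) (f : LT -> S).
Proof. by move=> mD mf _ B mB; apply: borel_lebesgue; exact: mf. Qed.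

(** Each substitution of the proof is a reflection; unlike translations these are
involutions, so that no inverse map has to be carried along. *)
Definition mirror (c : R) : R -> R := fun x => (c - x)%R.

Lemma mirrorK c : involutive (mirror c).
Proof. by move=> x; rewrite /mirror opprB addrC subrK. Qed.

(** A reflection maps half-open intervals to half-open intervals of the same
length, and these determine the measure on Borel sets. *)
Lemma lebesgue_measure_mirror c (A : set R) : measurable A ->
  lebesgue_measure (mirror c @^-1` A) = lebesgue_measure A.
Proof.
have mr : measurable_fun setT (mirror c : measurableTypeR R -> measurableTypeR R).
  by apply: measurable_funB => //; exact: measurable_cst.
move=> mA.
pose mrx := isMeasurableFun.Build _ _ _ _ _ mr.
pose r : {mfun _ >-> _} := HB.pack (mirror c : measurableTypeR R -> measurableTypeR R) mrx.
apply/esym.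
have := @lebesgue_measure_unique R [the measure _ _ of pushforward (@lebesgue_measure R) r].
apply => // _ [[a b]] _ <-.
rewrite /= /pushforward.
(* The reflected interval is closed on the left; the length does not see this. *)
have -> : mirror c @^-1` `]a, b] = `[(c - b)%R, (c - a)%R[%classic.
  apply/seteqP; split => x /=; rewrite /mirror !in_itv/= => /andP[? ?];
  by apply/andP; split; lra.
rewrite !lebesgue_measure_itv/= !lte_fin ltrD2l ltrN2 -!EFinD.
by case: ifP => // _; congr (_%:E); lra.
Qed.

(** Outer regularity by open sets reduces arbitrary sets to Borel sets.  The
invariance for all sets is what [measurable_mirror] builds on. *)
Lemma lebesgue_mirror c (A : set R) : mu (mirror c @^-1` A) = mu A.
Proof.
suff le B : mu (mirror c @^-1` B) <= mu B.
  apply/eqP; rewrite eq_le le/=.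
  rewrite -[X in mu X <= _](_ : mirror c @^-1` (mirror c @^-1` A) = A) ?le//.
  by apply/funext => x; rewrite /preimage/= mirrorK.
apply/lee_addgt0Pr => e e0.
have [U [oU AU mUA]] := outer_measure_open_le B e0.
apply: le_trans mUA; rewrite -(@lebesgue_measure_mirror c); last first.
  exact: open_measurable.
by apply: le_outer_measure => x /AU.
Qed.

(** Lebesgue measurability is measurability in the sense of Caratheodory; its
definition mentions the outer measure only. *)
Lemma lebesgue_measurableP (A : set R) : measurable (A : set LT) <->
  forall X, mu X = mu (X `&` A) + mu (X `&` ~` A).
Proof. by split; apply. Qed.

(** The Caratheodory condition is invariant under every bijection that preserves
the outer measure of all sets. *)
Lemma measurable_mirror c (A : set R) :
  measurable (A : set LT) -> measurable (mirror c @^-1` A : set LT).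
Proof.
move=> /lebesgue_measurableP mA; apply/lebesgue_measurableP => X.
have E (B : set R) : X `&` mirror c @^-1` B = mirror c @^-1` (mirror c @^-1` X `&` B).
  by apply/funext => x; rewrite /setI/preimage/= mirrorK.
have {E}mE B : mu (X `&` mirror c @^-1` B) = mu (mirror c @^-1` X `&` B).
  by rewrite E; exact: lebesgue_mirror.
rewrite -(lebesgue_mirror c X) (mA (mirror c @^-1` X)).
by congr (_ + _); rewrite -mE.
Qed.

Lemma measurable_fun_mirror c : measurable_fun setT (mirror c : LT -> LT).
Proof. by move=> _ B mB; rewrite setTI; exact: measurable_mirror. Qed.

Local Close Scope ereal_scope.

Lemma lebesgue_itvE (i : interval R) :
  mu [set` i] = (if i.1 < i.2 then (i.2 : \bar R) - i.1 else 0)%E.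
Proof. by rewrite lebesgueE lebesgue_measure_itv. Qed.

(** Two translates of an interval by [x] and [x'] differ, on each side, by an
interval of length [`|x - x'|]. *)
Lemma translated_mass_lipschitz (p q x x' : R) (A : set LT) : measurable A ->
  `|fine (mu (`[p - x, q - x[%classic `&` A)) -
    fine (mu (`[p - x', q - x'[%classic `&` A))| <= `|x - x'|.
Proof.
wlog xx' : x x' / x <= x' => [H mA|mA].
  have [/H/(_ mA)//|/ltW/H/(_ mA)] := leP x x'.
  by rewrite distrC (distrC x' x).
pose I y := `[p - y, q - y[%classic : set LT.
have mI y : measurable (I y) by exact: lebesgue_itv.
have mIA y : measurable (I y `&` A) by exact: measurableI.
have fI y : (mu (I y `&` A) < +oo)%E.
  apply: (@le_lt_trans _ _ (mu (I y))).
    by apply: le_measure; [exact/mem_set|exact/mem_set|exact: subIsetl].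
  by rewrite lebesgue_itvE/=; case: ifP => _; rewrite ?ltry// -EFinB ltry.
have fn y : mu (I y `&` A) \is a fin_num by rewrite ge0_fin_numE.
have gap (u : R) : mu (`[u - x', u - x[%classic : set LT) = (x' - x)%:E.
  rewrite lebesgue_itvE/= lte_fin ltrD2l ltrN2.
  case: ltP => [_|x'x]; first by rewrite -EFinB; congr (_%:E); lra.
  by congr (_%:E); lra.
have key (y y' u : R) : (I y `&` A `<=` (I y' `&` A) `|` `[u - x', u - x[%classic) ->
    fine (mu (I y `&` A)) <= fine (mu (I y' `&` A)) + (x' - x).
  move=> sub; rewrite -lee_fin EFinD !fineK// -(gap u).
  apply: (le_trans _ (measureU2 _ (mIA y') (lebesgue_itv _))).
  apply: le_measure; [exact/mem_set| |exact: sub].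
  by apply/mem_set; apply: measurableU => //; exact: lebesgue_itv.
rewrite ler_norml; apply/andP; split.
  have := @key x' x p; rewrite ler0_norm ?subr_le0//.
  move=> H; rewrite -/(I x) -/(I x') opprK.
  suff : fine (mu (I x' `&` A)) <= fine (mu (I x `&` A)) + (x' - x) by lra.
  apply: H => v []; rewrite /I/= !in_itv/= => /andP[v1 v2] Av.
  have [xv|xv] := ltP v (p - x); [right|left; split => //]; apply/andP; split => //; lra.
have := @key x x' q; rewrite ler0_norm ?subr_le0//.
move=> H; rewrite -/(I x) -/(I x').
suff : fine (mu (I x `&` A)) <= fine (mu (I x' `&` A)) + (x' - x) by lra.
apply: H => v []; rewrite /I/= !in_itv/= => /andP[v1 v2] Av.
have [xv|xv] := ltP v (q - x'); [left; split => //|right]; apply/andP; split => //; lra.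
Qed.

End lebesgue.

(** * Simple functions through labellings *)

Section labelled_simple.
Context d (T : measurableType d) (R : realType).
Variables (mu : {measure set T -> \bar R}) (D : set T) (mD : measurable D).
Local Open Scope ereal_scope.

(** A simple function is handled as [Y \o a], where [a] labels the points by a
finite type and has measurable fibers.  Labellings can be paired, so that two
simple functions always have a common one, and [Y] need not be injective. *)
Definition measurable_label (I : finType) (a : T -> I) :=
  forall i, measurable (a @^-1` [set i]).

Definition fiber_mass (I : finType) (a : T -> I) (i : I) : \bar R :=
  mu (D `&` a @^-1` [set i]).

Lemma measurable_label_pred (I : finType) (a : T -> I) (P : set I) :
  measurable_label a -> measurable (a @^-1` P).
Proof.
move=> ma; rewrite (_ : _ @^-1` _ = \bigcup_(i in P) a @^-1` [set i]).
  by apply: fin_bigcup_measurable => //; exact: finite_finset.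
by apply/seteqP; split => [x Px|x [i Pi /= ai]]; [exists (a x)|rewrite ai].
Qed.

Lemma measurable_fun_label d' (S : measurableType d') (I : finType) (a : T -> I)
    (g : I -> S) (E : set T) :
  measurable_label a -> measurable_fun E (g \o a).
Proof.
move=> ma mE B mB; apply: measurableI => //.
by rewrite comp_preimage; exact: measurable_label_pred.
Qed.

Lemma measurable_label_pair (I J : finType) (a : T -> I) (b : T -> J) :
  measurable_label a -> measurable_label b ->
  measurable_label (fun x => (a x, b x)).
Proof.
move=> ma mb; case=> i j.
rewrite (_ : _ @^-1` _ = a @^-1` [set i] `&` b @^-1` [set j]).
  exact: measurableI.
by apply/seteqP; split => x /= [] -> ->.
Qed.

Lemma fiber_mass_pred (I : finType) (a : T -> I) (P : pred I) :
  measurable_label a ->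
  mu (D `&` a @^-1` [set i | P i]) = \sum_(i | P i) fiber_mass a i.
Proof.
move=> ma; pose r := enum P.
have -> : D `&` a @^-1` [set i | P i] =
    \bigcup_(i in [set` r]) (D `&` a @^-1` [set i]).
  apply/seteqP; split => [x [Dx Px]|x [i /=]]; last first.
    by by rewrite mem_enum => Pi [Dx ->].
  by exists (a x) => //=; rewrite mem_enum.
rewrite measure_fin_bigcup//.
- by rewrite -fsbig_seq ?enum_uniq//= big_enum.
- by move=> i j _ _ [x [[_ /= ai] [_ /= aj]]]; rewrite -ai -aj.
- by move=> i _; exact: measurableI.
Qed.

(** The scalar counterpart of [vsimple_integral_label]. *)
Lemma integral_label (I : finType) (a : T -> I) (g : I -> R) :
  measurable_label a -> (forall i, 0 <= g i)%R ->
  \int[mu]_(x in D) (g (a x))%:E = \sum_i (g i)%:E * fiber_mass a i.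
Proof.
move=> ma g0; transitivity (\int[mu]_(x in D)
    \sum_i (g i * \1_(a @^-1` [set i]) x)%:E).
  apply: eq_integral => x _; rewrite sumEFin; congr (_%:E).
  rewrite (bigD1 (a x))//= indicE mem_set// mulr1 big1 ?addr0// => i ia.
  by rewrite indicE memNset ?mulr0//= => ai; rewrite ai eqxx in ia.
rewrite ge0_integral_sum//; last 2 first.
- move=> i; apply/measurable_EFinP; apply: measurable_funM => //.
- by move=> i x _; rewrite lee_fin mulr_ge0.
apply: eq_bigr => i _; under eq_integral do rewrite EFinM.
rewrite ge0_integralZl ?lee_fin//.
- by rewrite integral_indic// setIC.
- exact/measurable_EFinP.
Qed.

Variable V : normedModType R[i].

Lemma vsimple_label (I : finType) (a : T -> I) (Y : I -> V) :
  measurable_label a -> vsimple (Y \o a).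
Proof.
move=> ma; split.
  apply: (@sub_finite_set _ _ (Y @` setT)).
    by move=> _ [x _ <-]; exists (a x).
  exact/finite_image/finite_finset.
by move=> y; rewrite comp_preimage; exact: measurable_label_pred.
Qed.

Lemma vsimple_labelling (s : T -> V) : vsimple s ->
  exists (I : finType) (a : T -> I) (Y : I -> V),
    [/\ measurable_label a, forall x, s x = Y (a x) & injective Y].
Proof.
move=> [fs ms]; pose F := fset_set (range s).
have sF x : s x \in F by rewrite in_fset_set//; apply/mem_set; exists x.
exists {: F}, (fun x => [` sF x]%fset), val; split => //.
  move=> i; rewrite (_ : _ @^-1` _ = s @^-1` [set val i])//.
  by apply/seteqP; split => x /= => [<-//|xi]; apply: val_inj.
Qed.

(** The integral of a simple function is defined by its values; it can be computed
from any labelling, because the fibers of labels with equal value add up.  Fibers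
of infinite measure carry the value 0 and contribute nothing to either side. *)
Lemma vsimple_integral_label (I : finType) (a : T -> I) (Y : I -> V) :
  measurable_label a -> (forall i, Y i <> 0%R -> fiber_mass a i < +oo) ->
  vsimple_integral mu D (Y \o a) =
  (\sum_i (fine (fiber_mass a i))%:C%C *: Y i)%R.
Proof.
move=> ma Yfin; rewrite /vsimple_integral.
have fY : finite_set (range Y) by exact/finite_image/finite_finset.
(* Labels that do not occur have an empty fiber. *)
rewrite (fsbig_widen _ (range Y)); last 2 first.
- by move=> _ [x _ <-]; exists (a x).
- move=> y [_ Ny] /=; rewrite (_ : _ @^-1` _ = set0) ?setI0 ?measure0 ?scale0r//.
  by apply/seteqP; split => // x /= xy; apply: Ny; exists x.
rewrite fsbig_finite//=.
transitivity (\sum_(y <- fset_set (range Y)) \sum_(i | Y i == y)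
    (fine (fiber_mass a i))%:C%C *: Y i)%R.
  apply: eq_bigr => y _; have [->|y0] := eqVneq y 0%R.
    by rewrite scaler0 big1// => i /eqP ->; rewrite scaler0.
  rewrite (_ : _ @^-1` _ = a @^-1` [set i | Y i == y]); last first.
    by apply/seteqP; split => x /= => [->//|/eqP].
  rewrite fiber_mass_pred// -sum_fine; last first.
    move=> i /eqP Yi; rewrite ge0_fin_numE//; apply: Yfin; rewrite Yi.
    exact/eqP.
  rewrite rmorph_sum/= scaler_suml; by apply: eq_bigr => i /eqP <-.
rewrite (exchange_big_dep predT)//; apply: eq_bigr => i _.
rewrite -big_filter (_ : [seq y <- _ | _] = [:: Y i]) ?big_seq1//.
apply: perm_small_eq => //; apply: uniq_perm => //.
  by rewrite filter_uniq// fset_uniq.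
move=> y; rewrite mem_filter in_cons in_nil orbF eq_sym.
have [->|//] := eqVneq y (Y i).
by rewrite ?eqxx in_fset_set// mem_set//; exists i.
Qed.

(** On a common labelling the difference of the integrals is again a sum over
labels, and the triangle inequality applies termwise.  This replaces linearity of
the integral. *)
Lemma vsimple_integral_dist (s1 s2 : T -> V) :
  vsimple_integrable mu D s1 -> vsimple_integrable mu D s2 ->
  (rnorm (vsimple_integral mu D s1 - vsimple_integral mu D s2))%:E <=
  \int[mu]_(x in D) (rnorm (s1 x - s2 x))%:E.
Proof.
move=> [/vsimple_labelling[I1 [a1 [Y1 [ma1 s1E Y1i]]]] s1fin].
move=> [/vsimple_labelling[I2 [a2 [Y2 [ma2 s2E Y2i]]]] s2fin].
pose a x := (a1 x, a2 x); have ma : measurable_label a.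
  exact: measurable_label_pair.
have fin1 i : Y1 i.1 <> 0%R -> fiber_mass a i < +oo.
  move=> /s1fin; apply: le_lt_trans; apply: le_measure.
  - by apply/mem_set; exact: measurableI.
  - apply/mem_set; rewrite (_ : s1 = Y1 \o a1); last exact/funext.
    by apply: measurableI => //; rewrite comp_preimage; exact: measurable_label_pred.
  - by move=> x [Dx <-]; split => //=; rewrite s1E.
have fin2 i : Y2 i.2 <> 0%R -> fiber_mass a i < +oo.
  move=> /s2fin; apply: le_lt_trans; apply: le_measure.
  - by apply/mem_set; exact: measurableI.
  - apply/mem_set; rewrite (_ : s2 = Y2 \o a2); last exact/funext.
    by apply: measurableI => //; rewrite comp_preimage; exact: measurable_label_pred.
  - by move=> x [Dx <-]; split => //=; rewrite s2E.
rewrite (_ : s1 = (Y1 \o fst) \o a); last exact/funext.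
rewrite (_ : s2 = (Y2 \o snd) \o a); last exact/funext.
rewrite !vsimple_integral_label// -sumrB.
rewrite (integral_label (g := fun i => rnorm (Y1 i.1 - Y2 i.2)%R) ma); last first.
  by move=> i; exact: rnorm_ge0.
rewrite (@le_trans _ _ (\sum_i (rnorm ((fine (fiber_mass a i))%:C%C *: Y1 i.1
    - (fine (fiber_mass a i))%:C%C *: Y2 i.2)%R)%:E))//.
  by rewrite sumEFin lee_fin; exact: rnorm_sum.
apply: lee_sum => i _; rewrite -scalerBr rnormZ ger0_norm ?fine_ge0//.
have [->|Y12] := eqVneq (Y1 i.1) (Y2 i.2).
  by rewrite subrr rnorm0 mulr0 mul0e.
have fi : fiber_mass a i \is a fin_num.
  rewrite ge0_fin_numE//; have [Y10|/eqP] := eqVneq (Y1 i.1) 0%R; last exact: fin1.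
  by apply: fin2; rewrite -Y10; apply/eqP; rewrite eq_sym.
by rewrite EFinM fineK// muleC.
Qed.

End labelled_simple.

(** * The Bochner integral *)

Lemma cvge0_near_lt (R : realType) (u : nat -> \bar R) (e : R) :
  u n @[n --> \oo] --> 0%E -> 0 < e -> \forall n \near \oo, (u n < e%:E)%E.
Proof.
move=> /fine_cvgP[uf /cvgrPdist_lt u0] e0; near=> n.
have ufn : u n \is a fin_num by near: n.
rewrite -(fineK ufn) lte_fin (le_lt_trans (ler_norm _))//.
by rewrite -normrN -sub0r; near: n; exact: u0.
Unshelve. all: by end_near. Qed.

Section bochner_theory.
Context d (T : measurableType d) (R : realType).
Variables (mu : {measure set T -> \bar R}).
Hypothesis cmu : measure_is_complete mu.
Local Open Scope ereal_scope.

Section normed.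
Variable V : normedModType R[i].
Implicit Types (f : T -> V) (s t : T -> V) (D E : set T).

Lemma measurable_rnorm_vsimple E s t : vsimple s -> vsimple t ->
  measurable_fun E (fun x => (rnorm (s x - t x)%R)).
Proof.
move=> /vsimple_labelling[I1 [a1 [Y1 [ma1 s1E _]]]].
move=> /vsimple_labelling[I2 [a2 [Y2 [ma2 s2E _]]]].
pose a x := (a1 x, a2 x); have ma : measurable_label a.
  exact: measurable_label_pair.
rewrite (_ : (fun x => _) = (fun i => rnorm (Y1 i.1 - Y2 i.2)%R) \o a).
  exact: measurable_fun_label.
by apply/funext => x /=; rewrite s1E s2E.
Qed.

Lemma vsimple_cst (v : V) : vsimple (fun _ : T => v).
Proof.
split; first by apply: (@sub_finite_set _ _ [set v]) => // _ [x _ <-].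
move=> y; have [->|vy] := eqVneq y v.
  by rewrite (_ : _ @^-1` _ = setT)//; apply/seteqP; split.
rewrite (_ : _ @^-1` _ = set0)//; apply/seteqP; split => // x /= /esym/eqP.
by rewrite (negbTE vy).
Qed.

(** By completeness of the measure, an almost everywhere limit of measurable
functions is measurable; the upper limit is a measurable version of it. *)
Lemma measurable_rnorm_lim D (s : nat -> T -> V) f t : measurable D ->
  (forall n, vsimple (s n)) ->
  {ae mu, forall x, D x -> s n x @[n --> \oo] --> f x} ->
  vsimple t ->
  measurable_fun D (fun x => (rnorm (f x - t x)%R)%:E).
Proof.
move=> mD ss sf st; pose h n x := (rnorm (s n x - t x)%R)%:E.
apply: (ae_measurable_fun cmu (f := fun x => limn_esup (h^~ x))).
  apply: filterS sf => x sf Dx; apply: (cvg_limn_einf_sup _).2.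
  have /cvg_rnorm : (s n x - t x)%R @[n --> \oo] --> (f x - t x)%R.
    by apply: cvgB => //; [exact: sf|exact: cvg_cst].
  by move=> ?; apply: cvg_EFin => //; exact: nearW.
apply: measurable_fun_limn_esup => n; apply/measurable_EFinP.
exact: measurable_rnorm_vsimple.
Qed.

Lemma is_bochner_measurable D f t y : measurable D ->
  is_bochner_integral mu D f y -> vsimple t ->
  measurable_fun D (fun x => (rnorm (f x - t x)%R)%:E).
Proof.
move=> mD [s [ss sf _ _]]; apply: measurable_rnorm_lim sf => // n.
by have [] := ss n.
Qed.

(** For approximating simple functions [s1 n] and [s2 n] the triangle inequality
bounds the distance of the integrals by the integral of [h] plus four terms that
tend to 0.  The choice [f1 = f2], [h = 0] gives uniqueness. *)
Lemma bochner_dist D f1 f2 y1 y2 (h : T -> \bar R) : measurable D ->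
  is_bochner_integral mu D f1 y1 -> is_bochner_integral mu D f2 y2 ->
  measurable_fun D h ->
  (forall x, D x -> (rnorm (f1 x - f2 x)%R)%:E <= h x) ->
  (rnorm (y1 - y2)%R)%:E <= \int[mu]_(x in D) h x.
Proof.
move=> mD b1 b2 mh fh.
have h0 x : D x -> 0 <= h x.
  by move=> /fh; apply: le_trans; rewrite lee_fin rnorm_ge0.
have mb1 := is_bochner_measurable mD b1; have mb2 := is_bochner_measurable mD b2.
case: b1 b2 => [s1 [ss1 sf1 if1 is1]] [s2 [ss2 sf2 if2 is2]].
pose J s := vsimple_integral mu D s.
have dist n : (rnorm (y1 - y2)%R)%:E <=
    (rnorm (y1 - J (s1 n))%R)%:E + (\int[mu]_(x in D) (rnorm (f1 x - s1 n x)%R)%:E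
     + \int[mu]_(x in D) h x
    + \int[mu]_(x in D) (rnorm (f2 x - s2 n x)%R)%:E) + (rnorm (y2 - J (s2 n))%R)%:E.
  apply: (@le_trans _ _ ((rnorm (y1 - J (s1 n))%R)%:E +
    (rnorm (J (s1 n) - J (s2 n))%R)%:E + (rnorm (y2 - J (s2 n))%R)%:E)).
    rewrite -!EFinD lee_fin (rnormBC y2) -addrA.
    rewrite (le_trans (rnorm_dist_triangle (J (s1 n)) _ _))// lerD2l.
    exact: rnorm_dist_triangle.
  rewrite leeD2r// leeD2l// (le_trans (vsimple_integral_dist mD (ss1 n) (ss2 n)))//.
  have [[s1s _] [s2s _]] := (ss1 n, ss2 n).
  have m1 := mb1 _ s1s; have m2 := mb2 _ s2s.
  rewrite -ge0_integralD//; last by move=> x _; rewrite lee_fin rnorm_ge0.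
  rewrite -ge0_integralD//; last 3 first.
  - by move=> x Dx; rewrite adde_ge0 ?h0// lee_fin rnorm_ge0.
  - exact: emeasurable_funD.
  - by move=> x _; rewrite lee_fin rnorm_ge0.
  apply: ge0_le_integral => //.
  - by move=> x _; rewrite lee_fin rnorm_ge0.
  - by apply/measurable_EFinP; exact: measurable_rnorm_vsimple.
  - by apply: emeasurable_funD => //; exact: emeasurable_funD.
  move=> x Dx; apply: (@le_trans _ _ ((rnorm (f1 x - s1 n x)%R)%:E +
     (rnorm (f1 x - f2 x)%R)%:E + (rnorm (f2 x - s2 n x)%R)%:E)).
    rewrite -!EFinD lee_fin (rnormBC _ (s1 n x)) -addrA.
    rewrite (le_trans (rnorm_dist_triangle (f1 x) _ _))// lerD2l.
    exact: rnorm_dist_triangle.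
  by rewrite leeD2r// leeD2l// fh.
apply/lee_addgt0Pr => e e0.
have small (y : V) (s : nat -> T -> V) : J (s n) @[n --> \oo] --> y ->
    \forall n \near \oo, (rnorm (y - J (s n))%R)%:E <= (e / 4)%:E.
  move=> /cvg_rnormP/cvgrPdist_le/(_ (e / 4)%R)H.
  near=> n; rewrite lee_fin rnormBC -[leLHS]ger0_norm ?rnorm_ge0// -normrN -sub0r.
  by near: n; apply: H; rewrite divr_gt0.
have small' (u : nat -> \bar R) : u n @[n --> \oo] --> 0 ->
    \forall n \near \oo, u n <= (e / 4)%:E.
  move=> u0; near=> n; apply: ltW; near: n.
  by apply: cvge0_near_lt => //; rewrite divr_gt0.
have [n [n1 n2 n3 n4]] : exists n, [/\ (rnorm (y1 - J (s1 n))%R)%:E <= (e / 4)%:E,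
    (rnorm (y2 - J (s2 n))%R)%:E <= (e / 4)%:E,
    \int[mu]_(x in D) (rnorm (f1 x - s1 n x)%R)%:E <= (e / 4)%:E &
    \int[mu]_(x in D) (rnorm (f2 x - s2 n x)%R)%:E <= (e / 4)%:E].
  near \oo => n; exists n; split; near: n.
  - exact: small.
  - exact: small.
  - exact: small'.
  - exact: small'.
rewrite (le_trans (dist n))//.
apply: (@le_trans _ _ ((e / 4)%:E + ((e / 4)%:E + \int[mu]_(x in D) h x +
  (e / 4)%:E) + (e / 4)%:E)).
  by apply: leeD => //; apply: leeD => //; apply: leeD => //; exact: leeD.
rewrite [X in X <= _](_ : _ = \int[mu]_(x in D) h x + ((e / 4)%:E + (e / 4)%:E +
  (e / 4)%:E + (e / 4)%:E)).
  by rewrite -!EFinD leeD2l// lee_fin; lra.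
rewrite [(e / 4)%:E + (\int[mu]_(x in D) h x)]addeC.
rewrite -!addeA addeCA; congr (_ + _).
by rewrite addeCA.
Unshelve. all: by end_near. Qed.

Lemma is_bochner_unique D f y1 y2 : measurable D ->
  is_bochner_integral mu D f y1 -> is_bochner_integral mu D f y2 -> y1 = y2.
Proof.
move=> mD b1 b2; apply/eqP; rewrite -subr_eq0 -rnorm_eq0 eq_le rnorm_ge0 andbT.
rewrite -lee_fin (le_trans (bochner_dist (h := cst 0) mD b1 b2 _ _)) ?integral0//.
by move=> x _; rewrite subrr rnorm0.
Qed.

Lemma bochner_integralE D f y : measurable D ->
  is_bochner_integral mu D f y -> bochner_integral mu D f = y.
Proof.
move=> mD fy; apply: xget_unique => // z fz; exact: is_bochner_unique fz fy.
Qed.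

Section involution.
Variables (theta : T -> T).
Hypothesis thetaK : involutive theta.
Hypothesis mtheta : measurable_fun setT theta.
Hypothesis mu_theta : forall A, measurable A -> mu (theta @^-1` A) = mu A.

Let mtheta_mixin := isMeasurableFun.Build _ _ _ _ _ mtheta.
Let mtheta_pack : {mfun _ >-> _} := HB.pack theta mtheta_mixin.

Let mtheta_preimage A : measurable A -> measurable (theta @^-1` A).
Proof. by move=> mA; rewrite -[X in measurable X]setTI; exact: mtheta. Qed.

Let integral_theta D (f : T -> \bar R) : measurable D -> measurable_fun D f ->
  (forall x, D x -> 0 <= f x) ->
  \int[mu]_(x in theta @^-1` D) f (theta x) = \int[mu]_(x in D) f x.
Proof.
move=> mD mf f0.
rewrite -(@ge0_integral_pushforward _ _ T T R theta mtheta mu D f)//; last first.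
  by move=> x /set_mem; exact: f0.
apply: (@eq_measure_integral _ _ _ D mu
  [the measure _ _ of pushforward mu mtheta_pack]) => A mA _.
exact: mu_theta.
Qed.

Let vsimple_theta s : vsimple s -> vsimple (s \o theta).
Proof.
move=> [fs ms]; split; last by move=> y; rewrite comp_preimage; exact: mtheta_preimage.
by apply: sub_finite_set fs => _ [x _ <-]; exists (theta x).
Qed.

(** Composition with [theta] maps simple functions to simple functions with the
same values on fibers of the same mass, and preserves the integral of the error. *)
Lemma is_bochner_involution D f y : measurable D ->
  is_bochner_integral mu D f y ->
  is_bochner_integral mu (theta @^-1` D) (f \o theta) y.
Proof.
move=> mD bf; have mb := is_bochner_measurable mD bf.
have [s [ss sf If Is]] := bf.
have mass s' z : vsimple s' ->
    mu (theta @^-1` D `&` (s' \o theta) @^-1` [set z]) = mu (D `&` s' @^-1` [set z]).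
  move=> [_ ms']; rewrite comp_preimage -preimage_setI mu_theta//.
  by apply: measurableI.
exists (fun n => s n \o theta); split.
- move=> n; have [sn fn] := ss n; split; first exact: vsimple_theta.
  by move=> z /fn; rewrite mass.
- have [N [mN N0 PN]] := sf; exists (theta @^-1` N); split.
  + exact: mtheta_preimage.
  + by rewrite mu_theta.
  + by move=> x /= Nx; apply: PN.
- apply: cvg_trans If; apply: near_eq_cvg; near=> n.
  apply/esym; apply: (@integral_theta D (fun x => (rnorm (f x - s n x)%R)%:E)) => //.
    by apply: mb; have [] := ss n.
  by move=> x _; rewrite lee_fin rnorm_ge0.
- apply: cvg_trans Is; apply: near_eq_cvg; near=> n.
  rewrite /vsimple_integral (_ : range (s n \o theta) = range (s n)).
    apply: eq_fsbigr => z _; rewrite mass//; by have [] := ss n.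
  apply/seteqP; split => _ [x _ <-]; first by exists (theta x).
  by exists (theta x) => //=; rewrite thetaK.
Unshelve. all: by end_near. Qed.

End involution.
End normed.

(** By [vsimple_integral_dist], convergence in mean makes the integrals of the
approximants a Cauchy sequence. *)
Lemma is_bochner_cvg (V : completeNormedModType R[i]) (D : set T) (f : T -> V)
    (s : nat -> T -> V) : measurable D ->
  (forall n, vsimple_integrable mu D (s n)) ->
  {ae mu, forall x, D x -> s n x @[n --> \oo] --> f x} ->
  \int[mu]_(x in D) (rnorm (f x - s n x)%R)%:E @[n --> \oo] --> 0 ->
  exists2 y, vsimple_integral mu D (s n) @[n --> \oo] --> y &
             is_bochner_integral mu D f y.
Proof.
move=> mD ss sf If.
have : exists y : V, vsimple_integral mu D (s n) @[n --> \oo] --> y; last first.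
  by move=> [y sy]; exists y => //; exists s.
apply: cauchy_rnorm_cvg => e e0.
have [N _ HN] : \forall n \near \oo,
    \int[mu]_(x in D) (rnorm (f x - s n x)%R)%:E < (e / 2)%:E.
  by apply: cvge0_near_lt => //; rewrite divr_gt0.
exists N => m n Nm Nn; rewrite -lte_fin.
rewrite (le_lt_trans (vsimple_integral_dist mD (ss m) (ss n)))//.
rewrite (@le_lt_trans _ _ (\int[mu]_(x in D) (rnorm (f x - s m x)%R)%:E +
  \int[mu]_(x in D) (rnorm (f x - s n x)%R)%:E))//; last first.
  by rewrite (splitr e) EFinD lteD// HN.
have mf k : measurable_fun D (fun x => (rnorm (f x - s k x)%R)%:E).
  apply: (measurable_rnorm_lim mD _ sf); last by have [] := ss k.
  by move=> j; have [] := ss j.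
rewrite -ge0_integralD//; [|by move=> x _; rewrite lee_fin rnorm_ge0..].
apply: ge0_le_integral => //.
- by move=> x _; rewrite lee_fin rnorm_ge0.
- apply/measurable_EFinP; apply: measurable_rnorm_vsimple; first by have [] := ss m.
  by have [] := ss n.
- exact: emeasurable_funD.
- by move=> x _; rewrite -EFinD lee_fin (rnormBC (f x) (s m x)) rnorm_dist_triangle.
Unshelve. all: by end_near. Qed.

End bochner_theory.

Lemma vsimple_if d (T : measurableType d) (R : realType) (V : normedModType R[i])
    (B : T -> bool) (s : T -> V) :
  measurable [set x | B x] -> vsimple s -> vsimple (fun x => if B x then s x else 0).
Proof.
move=> mB /vsimple_labelling[I [a [Y [ma sE _]]]].
pose b x := (a x, B x).
have mb : measurable_label b.
  case=> i c; rewrite (_ : _ @^-1` _ =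
      a @^-1` [set i] `&` (if c then [set x | B x] else ~` [set x | B x])).
    by apply: measurableI; [exact: ma|case: c => //; exact: measurableC].
  apply/seteqP; split => x /=.
    by case=> ai <-; split; [exact: ai|case: ifPn => // /negP].
  by case: c => -[ai H]; congr (_, _) => //; apply/negbTE/negP.
rewrite (_ : (fun x => _) = (fun j : I * bool => if j.2 then Y j.1 else 0) \o b).
  exact: vsimple_label.
by apply/funext => x /=; rewrite sE.
Qed.

(** Where the norm of an approximant exceeds twice that of [f], it is replaced by 0.
This does not spoil convergence: if [f x] is not 0 the replacement stops after
finitely many steps, and if [f x = 0] the result is always 0. *)
Lemma dominated_vsimple d (T : measurableType d) (R : realType)
    (mu : {measure set T -> \bar R}) (V : normedModType R[i]) (f : T -> V) :
  measure_is_complete mu -> strongly_measurable mu setT f ->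
  exists s : nat -> T -> V, [/\ forall n, vsimple (s n),
    forall n x, rnorm (s n x) <= 2 * rnorm (f x) &
    {ae mu, forall x, s n x @[n --> \oo] --> f x}].
Proof.
move=> cmu [s [ss sf]].
have mf : measurable_fun setT (fun x => rnorm (f x)).
  apply/measurable_EFinP.
  have := measurable_rnorm_lim cmu measurableT ss sf (vsimple_cst T (0 : V)).
  by under eq_fun do rewrite subr0.
have ms n : measurable_fun setT (fun x => rnorm (s n x)).
  have := measurable_rnorm_vsimple (E := setT) (ss n) (vsimple_cst T (0 : V)).
  by under eq_fun do rewrite subr0.
pose t n x := if rnorm (s n x) <= 2 * rnorm (f x) then s n x else 0.
exists t; split.
- move=> n; apply: vsimple_if => //; rewrite -[X in measurable X]setTI.
  by apply: measurable_fun_le => //; exact: measurable_funM.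
- by move=> n x; rewrite /t; case: ifPn => // _; rewrite rnorm0 mulr_ge0 ?rnorm_ge0.
- apply: filterS sf => x /(_ I) sf.
  have [f0|f0] := eqVneq (f x) 0.
    rewrite (_ : (fun n => t n x) = cst 0); first by rewrite f0; exact: cvg_cst.
    apply/funext => n; rewrite /t f0 rnorm0 mulr0.
    case: ifPn => // H; apply/eqP; rewrite -rnorm_eq0 eq_le H/=; exact: rnorm_ge0.
  apply: (cvg_trans _ sf); apply: near_eq_cvg.
  have fx0 : 0 < rnorm (f x) by rewrite lt_neqAle rnorm_ge0 eq_sym rnorm_eq0 f0.
  move: sf => /cvg_rnorm sf; near=> n; rewrite /t ifT//.
  near: n; apply: (cvgr_le _ sf); lra.
Unshelve. all: by end_near. Qed.

Section dominated_products.
Context d (S : measurableType d) (R : realType) (mu : {measure set S -> \bar R}).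
Variables (D : set S) (mD : measurable D).
Local Open Scope ereal_scope.

Lemma dominated_product_cvg0 (K W : S -> R) (r : nat -> S -> R) :
  measurable_fun D K -> measurable_fun D W ->
  (forall n, measurable_fun D (r n)) ->
  (forall v, 0 <= K v)%R -> (forall n v, 0 <= r n v <= 3 * W v)%R ->
  {ae mu, forall v, D v -> r n v @[n --> \oo] --> 0%R} ->
  \int[mu]_(v in D) (K v * W v)%:E < +oo ->
  \int[mu]_(v in D) (K v * r n v)%:E @[n --> \oo] --> 0.
Proof.
move=> mK mW mr K0 rW r_cvg KW.
have W0 v : (0 <= W v)%R by have /andP[] := rW 0%N v; lra.
have mKW : measurable_fun D (fun v => (K v * W v)%:E).
  by apply/measurable_EFinP; exact: measurable_funM.
have [] := @dominated_convergence _ _ _ mu D mD (fun n v => (K v * r n v)%:E) (cst 0)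
  (fun v => 3%:E * (K v * W v)%:E).
- by move=> n; apply/measurable_EFinP; exact: measurable_funM.
- exact: measurable_cst.
- apply: filterS r_cvg => v rv Dv; apply: cvg_EFin; first exact: nearW.
  by rewrite -(mulr0 (K v)); apply: cvgM; [exact: cvg_cst|exact: rv].
- apply/integrableP; split; first exact: measurable_funeM.
  under eq_integral do rewrite gee0_abs ?mule_ge0 ?lee_fin ?mulr_ge0//.
  rewrite ge0_integralZl//; first by rewrite lte_mul_pinfty.
  by move=> v _; rewrite lee_fin mulr_ge0.
- apply: nearW => v n Dv; have /andP[r0 r3] := rW n v.
  rewrite -EFinM mulrCA gee0_abs; last by rewrite lee_fin mulr_ge0.
  by rewrite lee_fin ler_wpM2l.
- by move=> _ _; rewrite integral0.
Qed.

Lemma ge0_integral_le_add_indic (B : set S) (f e : S -> R) (c l : R) :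
  measurable B -> measurable_fun D f -> measurable_fun D e ->
  (forall v, 0 <= f v)%R -> (forall v, 0 <= e v)%R -> (0 <= c)%R ->
  mu (B `&` D) <= l%:E -> (forall v, D v -> f v <= e v + c * \1_B v)%R ->
  \int[mu]_(v in D) (f v)%:E <= \int[mu]_(v in D) (e v)%:E + (c * l)%:E.
Proof.
move=> mB mf me f0 e0 c0 Bl fe.
have m1 : measurable_fun D (\1_B : S -> R) by exact: measurable_indic.
apply: (@le_trans _ _ (\int[mu]_(v in D) ((e v)%:E + c%:E * (\1_B v)%:E))).
  apply: ge0_le_integral => //.
  - by move=> v _; rewrite lee_fin.
  - exact/measurable_EFinP.
  - apply: emeasurable_funD; first exact/measurable_EFinP.
    by apply: measurable_funeM; exact/measurable_EFinP.
have me' : measurable_fun D (fun v => (e v)%:E) by exact/measurable_EFinP.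
have mc : measurable_fun D (fun v => c%:E * (\1_B v)%:E).
  by apply: measurable_funeM; exact/measurable_EFinP.
rewrite (ge0_integralD mu mD _ me' _ mc); last 2 first.
- by move=> v _; rewrite lee_fin.
- by move=> v _; rewrite mule_ge0 ?lee_fin.
rewrite leeD2l// ge0_integralZl//; last by exact/measurable_EFinP.
by rewrite integral_indic// EFinM lee_wpmul2l.
Qed.

End dominated_products.

(** * Operator-valued kernels and their step approximations *)

Section operator_family.
Context {R : realType} {X Y : normedModType R[i]}.
Variable T : R -> {linear X -> Y}.
Hypothesis T_bounded : forall t : R, 0 < t -> bounded_near (T t) (nbhs (0 : X)).
Hypothesis T_continuous :
  forall (v : X) (t : R), 0 < t -> {for t, continuous (fun s => T s v)}.
Notation LT := (lebesgueType R).

(** The operator norm of a strongly continuous family is a supremum of continuous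
functions, hence lower semicontinuous. *)
Lemma measurable_opnorm (x : R) :
  measurable_fun (`]- x, +oo[ : set LT) (fun v : LT => opnorm (T (v + x))).
Proof.
apply: measurable_fun_borel => //.
apply: (measurability _ (RGenOInfty.measurableE R)) => //.
move=> _ [_ [c ->] <-]; apply: open_measurable.
rewrite openE => v /= [vx]; rewrite /interior in_itv/= andbT => cT.
have vx0 : 0 < v + x by move: vx; rewrite in_itv/= andbT; lra.
have [z [u /= u1 <-] cz] : exists2 z,
    [set rnorm (T (v + x) u) | u in [set u : X | rnorm u <= 1]] z & c < z.
  by apply: sup_gt cT; have [] := opnorm_has_sup (T_bounded vx0).
have Tu : (fun s => rnorm (T (s + x) u)) s @[s --> v] --> rnorm (T (v + x) u).
  apply: cvg_rnorm.
  apply: (@cvg_comp _ _ _ (fun s : R => s + x) (fun s => T s u) _ (nbhs (v + x))).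
    by apply: cvgD => //; exact: cvg_cst.
  exact: T_continuous.
have xv : - x < v by lra.
near=> s; have xs : - x < s by near: s; exact: lt_nbhsr.
split; first by rewrite /= in_itv/= xs.
rewrite /= in_itv/= andbT.
have sx0 : 0 < s + x by lra.
apply: (@lt_le_trans _ _ (rnorm (T (s + x) u))).
  by near: s; exact: (cvgr_gt _ Tu).
apply: (le_trans (opnorm_le u (T_bounded sx0))).
by rewrite ler_piMr ?opnorm_ge0.
Unshelve. all: by end_near. Qed.

(** Heine's theorem for the finitely many continuous functions
[r |-> T r (y i)] on the compact interval [[a, b]]. *)
Lemma uniform_mesh (a b e : R) (I : finType) (y : I -> X) : 0 < a -> 0 < e ->
  \forall h \near 0^'+, forall i r r', a <= r <= b -> `|r - r'| <= h ->
    rnorm (T r (y i) - T r' (y i)) <= e.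
Proof.
move=> a0 e0.
have H i : \forall h \near 0^'+, forall r r', a <= r <= b -> `|r - r'| <= h ->
    rnorm (T r (y i) - T r' (y i)) <= e.
  have : \forall h \near 0^'+, `[a, b] `<=`
      (fun r => forall r', `|r - r'| <= h -> rnorm (T r (y i) - T r' (y i)) <= e).
    apply: ((compact_near_coveringP `[a, b]).1 (@segment_compact R a b) R (0^'+)
    (fun h r => forall r', `|r - r'| <= h -> rnorm (T r (y i) - T r' (y i)) <= e)).
    move=> r; rewrite /= in_itv/= => /andP[ar rb].
    have r0 : 0 < r by exact: lt_le_trans ar.
    have /cvg_rnormP/cvgrPdist_le/(_ (e / 2)) := @T_continuous (y i) r r0.
    rewrite divr_gt0// => /(_ isT)/nbhs_ballP[d /= d0 Td].
    have Td' s : `|r - s| < d -> rnorm (T s (y i) - T r (y i)) <= e / 2.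
      by move=> /Td; rewrite /= sub0r normrN ger0_norm ?rnorm_ge0.
    exists (ball r (d / 2), [set h | h < d / 2]).
      split; first by apply: nbhsx_ballx; rewrite divr_gt0.
      by apply: nbhs_right_lt; rewrite divr_gt0.
    move=> [s h]/= [rs hd] s' ss'; rewrite /ball/= in rs.
    have := Td' s; have := Td' s'.
    have rs' : `|r - s'| < d.
      rewrite (le_lt_trans (ler_distD s _ _))// (splitr d) ltrD//.
      exact: le_lt_trans hd.
    have rsd : `|r - s| < d by lra.
    move=> /(_ rs') A /(_ rsd) B.
    rewrite (le_trans (rnorm_dist_triangle (T r (y i)) _ _))//.
    by rewrite (rnormBC (T r _)) (splitr e) lerD.
  apply: filterS => h H r r' rab; apply: H; by rewrite /= in_itv.
exact: filter_forall.
Unshelve. all: by end_near. Qed.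

End operator_family.

Section step_approximation.
Context {R : realType} {X Y : normedModType R[i]}.
Variable T : R -> {linear X -> Y}.
Variables (a L : R) (N : nat).
Hypotheses (a0 : 0 < a) (L0 : 0 < L).
Notation LT := (lebesgueType R).
Notation mu := (@lebesgue R).
Notation D x := (`]- x, +oo[%classic : set LT).

Let h : R := L / N.+1%:R.
Let h0 : 0 < h. Proof. by rewrite divr_gt0. Qed.

Definition grid_index (r : R) : nat := Num.truncn ((r - a) / (L / N.+1%:R)).
Definition grid_point (j : nat) : R := a + j%:R * (L / N.+1%:R).

Lemma grid_indexP r : a <= r < a + L ->
  (grid_index r < N.+1)%N /\
  grid_point (grid_index r) <= r < grid_point (grid_index r).+1.
Proof.
move=> /andP[ar rL].
have r0 : 0 <= (r - a) / h by rewrite divr_ge0 ?subr_ge0// ltW.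
have /andP[] := truncn_itv r0; rewrite -/(grid_index r).
rewrite ler_pdivlMr// ltr_pdivrMr// => t1 t2; split.
  rewrite truncn_lt_nat// ltr_pdivrMr// /h mulrCA mulfV ?mulr1//; lra.
by rewrite /grid_point -/h; apply/andP; split; lra.
Qed.

Lemma grid_index_eq (j : nat) r : grid_point j <= r < grid_point j.+1 ->
  grid_index r = j.
Proof.
rewrite /grid_point -/h => /andP[jr rj]; apply: truncn_def.
by rewrite -/h ler_pdivlMr// ltr_pdivrMr//; apply/andP; split; lra.
Qed.

Lemma grid_point_bounds (j : nat) r : (j < N.+1)%N ->
  grid_point j <= r < grid_point j.+1 -> a <= r < a + L.
Proof.
move=> jN; rewrite /grid_point -/h => /andP[jr rj].
have j0 : 0 <= j%:R * h by rewrite mulr_ge0 ?ler0n// ltW.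
have jL : j.+1%:R * h <= L.
  rewrite /h mulrCA ger_pMr// ler_pdivrMr// mul1r ler_nat//.
by apply/andP; split; lra.
Qed.

(** The approximant of [v |-> T (v + x) (s v)]: the kernel is cut off to
[[a, a + L[] and evaluated at the left end of the grid cell of [v + x]. *)
Definition stepfun (s : LT -> X) (x : R) : LT -> Y := fun v =>
  if a <= v + x < a + L then T (grid_point (grid_index (v + x))) (s v) else 0.

Section labels.
Variables (I : finType) (b : LT -> I) (y : I -> X).
Hypothesis mb : measurable_label b.

Definition step_label (x : R) (v : LT) : option 'I_N.+1 * I :=
  (if a <= v + x < a + L then Some (inord (grid_index (v + x))) else None, b v).

Definition step_value (ji : option 'I_N.+1 * I) : Y :=
  if ji.1 is Some j then T (grid_point j) (y ji.2) else 0.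

Lemma stepfun_label x : stepfun (y \o b) x = step_value \o step_label x.
Proof.
apply/funext => v; rewrite /stepfun/= /step_label /step_value /=.
by case: ifPn => // /grid_indexP[jN _]; rewrite inordK.
Qed.

(** The fiber of a grid cell is the fixed set [b @^-1` [set i]] intersected with a
translate of a fixed interval; this is where [x] enters. *)
Lemma step_label_some x j i : step_label x @^-1` [set (Some j, i)] =
  `[grid_point j - x, grid_point j.+1 - x[%classic `&` b @^-1` [set i].
Proof.
apply/seteqP; split => v; rewrite /preimage/= /step_label in_itv/=.
  case: ifPn => // vL [<- <-]; split => //.
  have [jN /andP[j1 j2]] := grid_indexP vL.
  by rewrite inordK//; apply/andP; split; lra.
move=> [/andP[v1 v2] <-].
have vj : grid_point j <= v + x < grid_point j.+1 by apply/andP; split; lra.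
rewrite (grid_point_bounds (ltn_ord j) vj) (grid_index_eq vj).
by congr (Some _, _); apply: val_inj; rewrite /= inordK.
Qed.

Lemma measurable_step_label x : measurable_label (step_label x).
Proof.
case=> [[j|] i].
  by rewrite step_label_some; apply: measurableI; [exact: lebesgue_itv|exact: mb].
rewrite (_ : _ @^-1` _ = ~` `[a - x, a + L - x[%classic `&` b @^-1` [set i]).
  by apply: measurableI; [apply: measurableC; exact: lebesgue_itv|exact: mb].
apply/seteqP; split => v; rewrite /preimage/= /step_label in_itv/=.
  case: ifPn => // vL [<-]; split => //; apply: contraNnot vL => /andP[v1 v2].
  by apply/andP; split; lra.
move=> [vL <-]; case: ifPn => // /andP[v1 v2]; exfalso; apply: vL.
by apply/andP; split; lra.
Qed.

Lemma step_mass x j i : fiber_mass mu (D x) (step_label x) (Some j, i) =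
  mu (`[grid_point j - x, grid_point j.+1 - x[%classic `&` b @^-1` [set i]).
Proof.
rewrite /fiber_mass step_label_some setIA; congr (mu (_ `&` _)).
apply/seteqP; split => [v [//]|v /=]; rewrite !in_itv/= andbT => /andP[v1 v2].
split; last by apply/andP.
have /(grid_point_bounds (ltn_ord j))/andP[v3 _] : grid_point j <= v + x < grid_point j.+1.
  by apply/andP; split; lra.
move: a0 v3; lra.
Qed.

Lemma step_mass_fin x ji : step_value ji <> 0 ->
  (fiber_mass mu (D x) (step_label x) ji < +oo)%E.
Proof.
case: ji => -[j|] i; last by rewrite /step_value.
move=> _; rewrite step_mass.
apply: (@le_lt_trans _ _ (mu (`[grid_point j - x, grid_point j.+1 - x[%classic : set LT))).
  apply: le_measure; [| |exact: subIsetl]; apply/mem_set; last exact: lebesgue_itv.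
  by apply: measurableI; [exact: lebesgue_itv|exact: mb].
by rewrite lebesgue_itvE/=; case: ifP => _; rewrite ?ltry// -EFinB ltry.
Qed.

Lemma step_integral_lipschitz_label : exists C : R, forall x x',
  rnorm (vsimple_integral mu (D x) (stepfun (y \o b) x) -
         vsimple_integral mu (D x') (stepfun (y \o b) x')) <= C * `|x - x'|.
Proof.
exists (\sum_ji rnorm (step_value ji)) => x x'.
have E z : vsimple_integral mu (D z) (stepfun (y \o b) z) =
    \sum_ji (fine (fiber_mass mu (D z) (step_label z) ji))%:C%C *: step_value ji.
  rewrite stepfun_label vsimple_integral_label//.
  - exact: lebesgue_itv.
  - exact: measurable_step_label.
  - exact: step_mass_fin.
rewrite !E -sumrB (le_trans (rnorm_sum _ _ _))// mulr_suml; apply: ler_sum => ji _.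
rewrite -scalerBl -rmorphB/= rnormZ mulrC.
case: ji => -[j|] i; last by rewrite /step_value/= rnorm0 !mul0r.
apply: ler_wpM2l; first exact: rnorm_ge0.
have := step_mass x j i; have := step_mass x' j i; rewrite /fiber_mass => -> ->.
exact: translated_mass_lipschitz.
Qed.

End labels.

Lemma vsimple_integrable_step (s : LT -> X) x : vsimple s ->
  vsimple_integrable mu (D x) (stepfun s x).
Proof.
move=> /vsimple_labelling[I [b [y [mb sE _]]]].
rewrite (_ : s = y \o b); last exact/funext.
rewrite stepfun_label; split.
  by apply: vsimple_label; exact: measurable_step_label.
move=> z z0.
have := fiber_mass_pred mu (lebesgue_itv `]- x, +oo[)
  [pred i | step_value y i == z] (measurable_step_label mb x).
rewrite (_ : step_label b x @^-1` _ = (step_value y \o step_label b x) @^-1` [set z]).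
  move=> ->; apply/lte_sum_pinfty => i /eqP yi; apply: (step_mass_fin (y := y)) => //.
  by rewrite yi.
by apply/seteqP; split => v /eqP.
Qed.

Lemma step_integral_lipschitz (s : LT -> X) : vsimple s ->
  exists C : R, forall x x',
  rnorm (vsimple_integral mu (D x) (stepfun s x) -
         vsimple_integral mu (D x') (stepfun s x')) <= C * `|x - x'|.
Proof.
move=> /vsimple_labelling[I [b [y [mb sE _]]]].
rewrite (_ : s = y \o b); last exact/funext.
exact: step_integral_lipschitz_label.
Qed.

End step_approximation.

Section convolution_approximation.
Context {R : realType} {X : normedModType R[i]} {Y : completeNormedModType R[i]}.
Variable T : R -> {linear X -> Y}.
Hypothesis T_bounded : forall t : R, 0 < t -> bounded_near (T t) (nbhs (0 : X)).
Hypothesis T_continuous :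
  forall (v : X) (t : R), 0 < t -> {for t, continuous (fun s => T s v)}.
Notation LT := (lebesgueType R).
Notation mu := (@lebesgue R).
Notation D x := (`]- x, +oo[%classic : set LT).

(** Since [s] takes finitely many values, one grid serves all points [v]. *)
Lemma fine_mesh (a L e : R) (s : LT -> X) : 0 < a -> 0 < L -> 0 < e -> vsimple s ->
  exists N : nat, forall r v, a <= r < a + L ->
    rnorm (T r (s v) - T (grid_point a L N (grid_index a L N r)) (s v)) <= e.
Proof.
move=> a0 L0 e0 /vsimple_labelling[I [b [y [_ sE _]]]].
have /nbhs_ballP[d /= d0 Hd] := uniform_mesh T_continuous (a + L) y a0 e0.
(* With [N.+1] cells the mesh [L / N.+1] is below [d]. *)
pose N := Num.truncn (L / d); exists N => r v arL.
have h0 : 0 < L / N.+1%:R by rewrite divr_gt0.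
have hd : L / N.+1%:R < d.
  rewrite ltr_pdivrMr// mulrC -ltr_pdivrMr//.
  by have /andP[] := truncn_itv (divr_ge0 (ltW L0) (ltW d0)).
rewrite sE; apply: (Hd (L / N.+1%:R)) => //.
- by rewrite /ball/= sub0r normrN ger0_norm// ltW.
- by move: arL => /andP[-> /ltW ->].
have [_] := grid_indexP N L0 arL.
rewrite /grid_point -[(grid_index a L N r).+1%:R]natr1 mulrDl mul1r => /andP[g1 g2].
move: (L / _) h0 hd g1 g2 => h h0 hd; move: (_ * h) => z g1 g2.
by rewrite ger0_norm; lra.
Qed.

Variable w : LT -> X.
Hypothesis w_measurable : strongly_measurable mu setT w.
Hypothesis w_integrable : forall x : R,
  (\int[mu]_(v in `](- x)%R, +oo[) (opnorm (T (v + x)%R) * rnorm (w v))%:E < +oo)%E.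

(** The error of the [n]-th approximant is bounded by [e n], which tends to 0
almost everywhere and is dominated by three times the integrable function
[K v * rnorm (w v)], plus the grid error on an interval of length [n+1]; the grid is
chosen so that the latter has integral at most [1/(n+1)].  Convergence holds for
every [x], although the dominating function depends on [x] in an uncontrolled way:
the grids do not depend on [x]. *)
Lemma convolution_lipschitz_approx : exists J : nat -> R -> Y,
  (forall n, exists C : R, forall x x', rnorm (J n x - J n x') <= C * `|x - x'|) /\
  forall x, exists2 y, J n x @[n --> \oo] --> y &
    is_bochner_integral mu (D x) (fun v => T (v + x) (w v)) y.
Proof.
have [s [ss sw sf]] := dominated_vsimple lebesgue_complete w_measurable.
pose a n : R := n.+1%:R^-1; pose L n : R := n.+1%:R.
have a0 n : 0 < a n by rewrite invr_gt0.
have L0 n : 0 < L n by rewrite ltr0n.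
(* The tolerated grid error; times the length [L n] it equals [a n]. *)
have e0 n : 0 < a n * a n by rewrite mulr_gt0.
have /choice[N HN] := fun n => fine_mesh (a0 n) (L0 n) (e0 n) (ss n).
pose st n x := stepfun T (a n) (L n) (N n) (s n) x.
exists (fun n x => vsimple_integral mu (D x) (st n x)); split => [n|x].
  by apply: step_integral_lipschitz => //.
pose f (v : LT) := T (v + x) (w v).
pose B n (v : LT) := a n <= v + x < a n + L n.
pose t n (v : LT) := if B n v then s n v else 0.
pose K (v : LT) := opnorm (T (v + x)).
have mD : measurable (D x) by exact: lebesgue_itv.
have mB n : measurable ([set v | B n v] : set LT).
  rewrite (_ : [set v | B n v] = `[a n - x, a n + L n - x[%classic).
    exact: lebesgue_itv.
  by apply/seteqP; split => v; rewrite /B /= in_itv/= => /andP[? ?]; apply/andP; split; lra.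
have vt n : vsimple (t n) by exact: (vsimple_if (mB n) (ss n)).
have evB v : D x v -> \forall n \near \oo, B n v.
  rewrite /= in_itv/= andbT => xv.
  have vx0 : 0 < v + x by lra.
  near=> n; apply/andP; split.
    by apply: ltW; near: n; exact: (near_infty_natSinv_lt (PosNum vx0)).
  apply: (@lt_le_trans _ _ (L n)); last by rewrite lerDr ltW.
  rewrite /L; apply: (@lt_trans _ _ n%:R); last by rewrite ltr_nat.
  near: n; exact: nbhs_infty_gtr.
have tf : {ae mu, forall v, D x v -> t n v @[n --> \oo] --> w v}.
  apply: filterS sf => v sv Dv; apply: cvg_trans sv; apply: near_eq_cvg.
  by apply: filterS (evB v Dv) => n Bv; rewrite /t Bv.
have mK : measurable_fun (D x) K by exact: measurable_opnorm.
have mw : measurable_fun (D x) (fun v => rnorm (w v)).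
  apply/measurable_EFinP.
  apply: eq_measurable_fun (measurable_rnorm_lim lebesgue_complete mD vt tf
    (vsimple_cst LT (0 : X))) => v _.
  by rewrite subr0.
have mwt n : measurable_fun (D x) (fun v => rnorm (w v - t n v)).
  by apply/measurable_EFinP; exact: (measurable_rnorm_lim lebesgue_complete mD vt tf (vt n)).
pose e n (v : LT) := K v * rnorm (w v - t n v).
have me n : measurable_fun (D x) (e n) by exact: measurable_funM.
have Dpos v : D x v -> 0 < v + x by rewrite /= in_itv/= andbT; lra.
have e_ge0 n v : 0 <= e n v by rewrite mulr_ge0 ?opnorm_ge0 ?rnorm_ge0.
have fst_le n v : D x v -> rnorm (f v - st n x v) <= e n v + a n * a n * \1_[set v | B n v] v.
  move=> /Dpos/T_bounded Tb; rewrite /st /stepfun -/(B n v) /e /t indicE.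
  have [Bv|Bv] := boolP (B n v).
    rewrite mem_set// mulr1 (le_trans (rnorm_dist_triangle (T (v + x) (s n v)) _ _))//.
    apply: lerD; last exact: HN.
    by rewrite /f -linearB; exact: opnorm_le.
  rewrite memNset; last by apply/negP.
  by rewrite mulr0 addr0 !subr0; exact: opnorm_le.
have r_cvg : {ae mu, forall v, D x v -> rnorm (w v - t n v) @[n --> \oo] --> (0 : R)}.
  apply: filterS tf => v tv Dv.
  have /cvg_rnormP := tv Dv.
  by under eq_fun do rewrite rnormBC.
have e_cvg : {ae mu, forall v, D x v -> e n v @[n --> \oo] --> (0 : R)}.
  apply: filterS r_cvg => v rv Dv.
  by rewrite -(mulr0 (K v)); apply: cvgM; [exact: cvg_cst|exact: rv].
have a_cvg : a n @[n --> \oo] --> (0 : R) by exact: cvg_harmonic.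
have st_cvg : {ae mu, forall v, D x v -> st n x v @[n --> \oo] --> f v}.
  apply: filterS e_cvg => v ev Dv; apply/cvg_rnormP.
  apply: (@squeeze_cvgr _ _ _ _ (cst 0) (fun n => e n v + a n * a n)).
  - near=> n; rewrite rnorm_ge0/= rnormBC (le_trans (fst_le n v Dv))// lerD2l.
    by rewrite ler_piMr// ?ltW// indicE; case: (_ \in _); rewrite ?ler01.
  - exact: cvg_cst.
  - rewrite -(addr0 0); apply: cvgD; first exact: ev.
    by rewrite -[X in _ --> X](mulr0 0); exact: cvgM.
have vst n : vsimple_integrable mu (D x) (st n x) by exact: vsimple_integrable_step.
have mfst n : measurable_fun (D x) (fun v => (rnorm (f v - st n x v))%:E).
  apply: (measurable_rnorm_lim lebesgue_complete mD _ st_cvg) => // [k|].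
    by have [] := vst k.
  by have [] := vst n.
apply: (is_bochner_cvg lebesgue_complete) => //.
have int_e : (\int[mu]_(v in D x) (e n v)%:E @[n --> \oo] --> 0)%E.
  apply: (dominated_product_cvg0 mD mK mw mwt) => [v|n v||].
  - exact: opnorm_ge0.
  - rewrite rnorm_ge0/= (le_trans (rnormD _ _))// rnormN.
    suff : rnorm (t n v) <= 2 * rnorm (w v) by lra.
    by rewrite /t; case: ifP => _; [exact: sw|rewrite rnorm0 mulr_ge0 ?rnorm_ge0].
  - exact: r_cvg.
  - exact: w_integrable.
apply: (@squeeze_cvge _ _ _ _ (cst 0%E) _
  (fun n => \int[mu]_(v in D x) (e n v)%:E + (a n)%:E)%E).
- near=> n; apply/andP; split; first by apply: integral_ge0 => v _; rewrite lee_fin rnorm_ge0.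
  have aL : a n = a n * a n * L n by rewrite -mulrA mulVf ?mulr1// gt_eqF.
  rewrite [in leRHS]aL.
  have mfs : measurable_fun (D x) (fun v => rnorm (f v - st n x v)).
    by apply/measurable_EFinP; exact: mfst.
  apply: (ge0_integral_le_add_indic mD (mB n) mfs (me n) _ _ _ _ (fst_le n)).
  + by move=> v; exact: rnorm_ge0.
  + exact: e_ge0.
  + exact: ltW.
  + apply: (@le_trans _ _ (mu (`[a n - x, a n + L n - x[%classic : set LT))).
      apply: le_measure; [apply/mem_set; exact: (measurableI _ _ (mB n) mD)| |].
        by apply/mem_set; exact: lebesgue_itv.
      by move=> v [/andP[v1 v2] _]; rewrite /= in_itv/=; apply/andP; split; lra.
    rewrite lebesgue_itvE/=; case: ifP => _; last by rewrite lee_fin ltW.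
    by rewrite -EFinB lee_fin; lra.
- exact: cvg_cst.
- rewrite -[X in _ --> X](adde0 0%E); apply: cvgeD => //.
  by apply: cvg_EFin; [exact: nearW|exact: a_cvg].
Unshelve. all: by end_near. Qed.

End convolution_approximation.

(** * Variable exponents *)

Section varphi_theory.
Context {R : realType}.
Local Open Scope ereal_scope.
Implicit Types (r : \bar R) (t : R).

Lemma varphi_ge0 r t : 0 <= varphi r t.
Proof.
case: r => [s| |] //=; first by rewrite lee_fin powR_ge0.
by case: ifP.
Qed.

Lemma le_varphi r s t : 0 <= r -> (0 <= s <= t)%R -> varphi r s <= varphi r t.
Proof.
case: r => [r| |]//= r0 /andP[s0 st].
  by rewrite lee_fin ge0_ler_powR// nnegrE// (le_trans s0).
by case: (leP t 1%R) => [t1|_]; [rewrite (le_trans st t1)|rewrite leey].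
Qed.

(** This is convexity of [varphi r] together with [varphi r 0 = 0]. *)
Lemma varphi_convex0 r k t : 1 <= r -> (0 < k <= 1)%R -> (0 <= t)%R ->
  varphi r (k * t)%R <= k%:E * varphi r t.
Proof.
case: r => [r| |]//= r1 /andP[k0 k1] t0; last first.
  case: (leP t 1%R) => [t1|_]; last by rewrite gt0_muley ?lte_fin// leey.
  by rewrite ifT ?mule0// (le_trans _ t1)// ler_piMl.
rewrite -EFinM lee_fin powRM ?(ltW k0)// ler_wpM2r ?powR_ge0//.
have [r0|] := eqVneq r 1%R; first by rewrite r0 powRr1// ltW.
move=> rn1; rewrite -[leRHS]powRr1 ?(ltW k0)// ger_powR// ?k0//.
Qed.

(** For finite exponents this is Young's inequality without the factors [1/p] and
[1/q], which are at most 1; if one exponent is infinite the other is 1. *)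
Lemma varphi_young (p q : \bar R) (a b : R) : 1 <= p -> 1 <= q -> p^-1 + q^-1 = 1 ->
  (0 <= a)%R -> (0 <= b)%R -> (a * b)%:E <= varphi q a + varphi p b.
Proof.
have inf1 (s : R) (x y : R) : 1 <= s%:E -> s%:E^-1 = 1 -> (0 <= x)%R -> (0 <= y)%R ->
    (x * y)%:E <= varphi s%:E x + varphi +oo y.
  move=> s1; have s0 : (0 < s)%R by rewrite (lt_le_trans ltr01).
  rewrite inver gt_eqF// => -[/eqP]; rewrite invr_eq1 => /eqP -> x0 y0 /=.
  case: (leP y 1%R) => y1; last by rewrite addey// leey.
  by rewrite adde0 lee_fin powRr1// ler_piMr.
case: p => [p| |]//; case: q => [q| |]//.
- rewrite lee_fin => p1; rewrite lee_fin => q1 pq a0 b0.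
  have p0 : (0 < p)%R by rewrite (lt_le_trans ltr01).
  have q0 : (0 < q)%R by rewrite (lt_le_trans ltr01).
  move: pq; rewrite !inver !gt_eqF// => -[pq].
  have qp : (q^-1 + p^-1 = 1)%R by rewrite addrC.
  rewrite /varphi -EFinD lee_fin (le_trans (conjugate_powR a0 b0 q0 p0 qp))//.
  rewrite lerD// ler_piMr ?powR_ge0// invf_le1//.
- move=> p1 _ /=; rewrite invey// adde0 => pq a0 b0.
  by rewrite addeC mulrC inf1.
- move=> _ q1 /=; rewrite invey// add0e => pq a0 b0.
  exact: inf1.
- by move=> _ _; rewrite invey adde0 => /eqP; rewrite eq_sym onee_eq0.
Qed.

Lemma measurable_varphi d (T : measurableType d) (D : set T) (p : T -> \bar R)
    (u : T -> R) : measurable D ->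
  measurable_fun D p -> (forall x, 1 <= p x) -> measurable_fun D u ->
  measurable_fun D (fun x => varphi (p x) (u x)).
Proof.
move=> mD mp p1 mu.
rewrite (_ : (fun x => _) = (fun x => if p x == +oo then
    (if (u x <= 1)%R then 0 else +oo) else
    ((if u x == 0%R then 0%R else expR (fine (p x) * ln (u x)))%:E))); last first.
  apply/funext => x; have := p1 x; case: (p x) => [r| |]//=.
  rewrite lee_fin => r1; rewrite /powR.
  by have [r0|//] := eqVneq r 0%R; move: r1; rewrite r0 ler10.
apply: measurable_fun_if => //.
- exact: measurable_fun_eqe.
- apply: (measurable_funS mD); first exact: subIsetl.
  apply: measurable_fun_if => //; exact: measurable_fun_ler.
- apply: (measurable_funS mD); first exact: subIsetl.
  apply/measurable_EFinP; apply: measurable_fun_if => //.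
    exact: measurable_fun_eqr.
  apply: (measurable_funS mD); first exact: subIsetl.
  apply: measurableT_comp => //; apply: measurable_funM.
    by apply: measurableT_comp => //; exact: fine_measurable.
  by apply: measurableT_comp => //; exact: measurable_ln.
Qed.

End varphi_theory.

Section luxemburg.
Context d {T : measurableType d} {R : realType}.
Variable mu : {measure set T -> \bar R}.
Local Open Scope ereal_scope.
Implicit Types (p q : T -> \bar R) (D : set T) (u a b : T -> R).

Definition exponent_on p : Prop := measurable_fun setT p /\ forall x, 1 <= p x.

Definition modular_on p D u : \bar R := \int[mu]_(x in D) varphi (p x) (u x).

(** [Lpnorm] is the case of Lebesgue measure. *)
Definition luxemburg p D u : \bar R :=
  ereal_inf [set lam%:E | lam in
    [set lam : R | (0 < lam)%R /\ modular_on p D (fun x => u x / lam)%R <= 1]].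

Lemma exponent_ge0 p x : exponent_on p -> 0 <= p x.
Proof. by move=> [_ /(_ x)]; apply: le_trans. Qed.

Lemma measurable_modular p D u : exponent_on p -> measurable D -> measurable_fun D u ->
  measurable_fun D (fun x => varphi (p x) (u x)).
Proof.
move=> [mp p1] mD mfu; apply: measurable_varphi => //.
exact: measurable_funTS.
Qed.

Lemma le_modular p D u v : exponent_on p -> measurable D ->
  measurable_fun D u -> measurable_fun D v ->
  (forall x, D x -> 0 <= u x <= v x)%R -> modular_on p D u <= modular_on p D v.
Proof.
move=> ep mD mfu mfv uv; apply: ge0_le_integral => //.
- by move=> x _; exact: varphi_ge0.
- exact: measurable_modular.
- exact: measurable_modular.
- by move=> x Dx; apply: le_varphi; [exact: exponent_ge0|exact: uv].
Qed.

Lemma modular_convex0 p D u (k : R) : exponent_on p -> measurable D ->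
  measurable_fun D u -> (forall x, D x -> 0 <= u x)%R -> (0 < k <= 1)%R ->
  modular_on p D (fun x => k * u x)%R <= k%:E * modular_on p D u.
Proof.
move=> ep mD mfu u0 k01; have [k0 k1] := andP k01.
rewrite /modular_on -ge0_integralZl ?lee_fin ?(ltW k0)//; last 2 first.
- exact: measurable_modular.
- by move=> x _; exact: varphi_ge0.
apply: ge0_le_integral => //.
- by move=> x _; exact: varphi_ge0.
- by apply: measurable_modular => //; exact: measurable_funM.
- by apply: measurable_funeM; exact: measurable_modular.
- by move=> x Dx; apply: varphi_convex0 => //; [case: ep|exact: u0].
Qed.

Lemma luxemburg_ge0 p D u : 0 <= luxemburg p D u.
Proof. by apply: le_ereal_inf_tmp => _ [lam [lam0 _] <-]; rewrite lee_fin ltW. Qed.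

Lemma luxemburg_le p D u (c : R) : (0 < c)%R ->
  modular_on p D (fun x => u x / c)%R <= 1 -> luxemburg p D u <= c%:E.
Proof. by move=> c0 uc; apply: ge_ereal_inf; exists c%:E => //; exists c. Qed.

(** By [modular_convex0] a finite modular becomes at most 1 after scaling. *)
Lemma luxemburg_lty p D u : exponent_on p -> measurable D ->
  (forall x, D x -> 0 <= u x)%R -> measurable_fun D u -> forall lam : R, (0 < lam)%R ->
  modular_on p D (fun x => lam * u x)%R < +oo -> luxemburg p D u < +oo.
Proof.
move=> ep mD u0 mfu lam lam0 ulam.
have M0 : 0 <= modular_on p D (fun x => lam * u x)%R.
  by apply: integral_ge0 => x _; exact: varphi_ge0.
pose M := fine (modular_on p D (fun x => lam * u x)%R).
have ME : modular_on p D (fun x => lam * u x)%R = M%:E.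
  by rewrite fineK// ge0_fin_numE.
have M0' : (0 <= M)%R by rewrite -lee_fin -ME.
(* This factor brings the modular [M] down to [M / (1 + M)]. *)
pose k : R := ((1 + M)^-1)%R.
have k0 : (0 < k)%R by rewrite invr_gt0 ltr_wpDr.
apply: (@le_lt_trans _ _ ((k * lam)^-1)%R%:E); last by rewrite ltry.
apply: luxemburg_le; first by rewrite invr_gt0 mulr_gt0.
apply: (@le_trans _ _ (k%:E * modular_on p D (fun x => lam * u x)%R)).
  rewrite invrK (_ : (fun x => u x * (k * lam))%R = (fun x => k * (lam * u x))%R); last first.
    by apply/funext => x; rewrite mulrC mulrA.
  apply: modular_convex0 => //.
  - exact: measurable_funM.
  - by move=> x Dx; rewrite mulr_ge0 ?u0// ltW.
  - by rewrite k0/= invf_le1 ?lerDl// ltr_wpDr.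
by rewrite ME -EFinM lee_fin mulrC ler_pdivrMr ?mul1r ?lerDr// ltr_wpDr.
Qed.

Lemma modular_div_le1 p D u (c : R) : exponent_on p -> measurable D ->
  measurable_fun D u -> (forall x, D x -> 0 <= u x)%R ->
  luxemburg p D u < c%:E -> modular_on p D (fun x => u x / c)%R <= 1.
Proof.
move=> ep mD mfu u0 /ereal_inf_lt[_ [lam [lam0 ulam] <-]]; rewrite lte_fin => lamc.
have c0 : (0 < c)%R by exact: lt_trans lamc.
apply: le_trans ulam; apply: le_modular => //.
- exact: measurable_funM.
- exact: measurable_funM.
move=> x Dx; rewrite divr_ge0 ?u0 ?(ltW c0)//= ler_wpM2l ?u0//.
by rewrite lef_pV2 ?posrE// ltW.
Qed.

(** If the norm is 0, then every multiple [n.+1 * u] has modular at most [k] for all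
[k <= 1], hence 0.  All multiples are needed: for an infinite exponent [varphi]
vanishes up to 1. *)
Lemma luxemburg_eq0_ae p D u : exponent_on p -> measurable D ->
  measurable_fun D u -> (forall x, D x -> 0 <= u x)%R ->
  luxemburg p D u = 0 -> {ae mu, forall x, D x -> u x = 0%R}.
Proof.
move=> ep mD mfu u0 N0.
pose M n := modular_on p D (fun x => n.+1%:R * u x)%R.
have M0 n : M n = 0.
  have M_ge0 : 0 <= M n by apply: integral_ge0 => x _; exact: varphi_ge0.
  apply/eqP; rewrite eq_le M_ge0 andbT; apply/lee_addgt0Pr => e e0.
  rewrite add0e; pose k : R := Num.min e 1%R.
  have k0 : (0 < k)%R by rewrite lt_min e0 ltr01.
  have k1 : (k <= 1)%R by rewrite ge_min lexx orbT.
  apply: (@le_trans _ _ k%:E); last by rewrite lee_fin ge_min lexx.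
  rewrite /M (_ : (fun x => _) = (fun x => k * (u x / (k / n.+1%:R)))%R); last first.
    apply/funext => x; rewrite invf_div mulrCA [(k * _)%R]mulrCA.
    by rewrite mulfV ?mulr1 ?gt_eqF// mulrC.
  have c0 : (0 < k / n.+1%:R)%R by rewrite divr_gt0.
  apply: (le_trans (modular_convex0 (k := k) ep mD _ _ _)).
  - exact: measurable_funM.
  - by move=> x Dx; rewrite divr_ge0 ?u0// ltW.
  - by rewrite k0.
  rewrite -[leRHS]mule1; apply: lee_wpmul2l; first by rewrite lee_fin ltW.
  by apply: modular_div_le1 => //; rewrite N0 lte_fin.
have ae0 n : {ae mu, forall x, D x -> varphi (p x) (n.+1%:R * u x)%R = 0}.
  have mv : measurable_fun D (fun x => varphi (p x) (n.+1%:R * u x)%R).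
    by apply: measurable_modular => //; exact: measurable_funM.
  apply/(ae_eq_integral_abs mu mD mv).
  by rewrite -(M0 n); apply: eq_integral => x _; rewrite gee0_abs// varphi_ge0.
apply: filterS (ae_foralln ae0) => x H Dx.
have ux0 := u0 x Dx.
move: H; have := ep.2 x; case: (p x) => [r| |]// r1 H.
  have := H 0%N Dx; rewrite mul1r /= => -[/eqP].
  by rewrite powR_eq0 => /andP[/eqP].
apply/eqP; rewrite eq_le ux0 andbT leNgt; apply/negP => uxp.
pose n := Num.truncn (u x)^-1.
have := H n Dx; rewrite /= ifF// leNgt; apply/negbTE/negPn.
rewrite -ltr_pdivrMr// mul1r.
by have /andP[] := truncn_itv (ltW (etrans (invr_gt0 _) uxp)).
Qed.

(** Integrating [varphi_young] for [a / Q] and [b / N] gives the constant 2.  As [Q]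
or [N] may vanish, both are first enlarged by [e]. *)
Lemma hoelder_varexp p q D a b (Q N : R) : exponent_on p -> exponent_on q ->
  (forall x, (p x)^-1 + (q x)^-1 = 1) -> measurable D ->
  measurable_fun D a -> measurable_fun D b ->
  (forall x, D x -> 0 <= a x)%R -> (forall x, D x -> 0 <= b x)%R ->
  luxemburg q D a = Q%:E -> luxemburg p D b = N%:E ->
  \int[mu]_(x in D) (a x * b x)%:E <= (2 * (Q * N))%:E.
Proof.
move=> ep eq pq mD ma mb a0 b0 aQ bN.
have Q0 : (0 <= Q)%R by rewrite -lee_fin -aQ luxemburg_ge0.
have N0 : (0 <= N)%R by rewrite -lee_fin -bN luxemburg_ge0.
have key (e : R) : (0 < e)%R ->
    \int[mu]_(x in D) (a x * b x)%:E <= (2 * ((Q + e) * (N + e)))%:E.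
  move=> e0; have Qe : (0 < Q + e)%R by rewrite ltr_wpDl.
  have Ne : (0 < N + e)%R by rewrite ltr_wpDl.
  have aQe : modular_on q D (fun x => a x / (Q + e))%R <= 1.
    by apply: modular_div_le1 => //; rewrite aQ lte_fin ltrDl.
  have bNe : modular_on p D (fun x => b x / (N + e))%R <= 1.
    by apply: modular_div_le1 => //; rewrite bN lte_fin ltrDl.
  have mq : measurable_fun D (fun x => varphi (q x) (a x / (Q + e))%R).
    by apply: measurable_modular => //; exact: measurable_funM.
  have mp : measurable_fun D (fun x => varphi (p x) (b x / (N + e))%R).
    by apply: measurable_modular => //; exact: measurable_funM.
  apply: (@le_trans _ _ (\int[mu]_(x in D) (((Q + e) * (N + e))%:E *
      (varphi (q x) (a x / (Q + e))%R + varphi (p x) (b x / (N + e))%R)))).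
    apply: ge0_le_integral => //.
    - by move=> x Dx; rewrite lee_fin mulr_ge0 ?a0 ?b0.
    - by apply/measurable_EFinP; exact: measurable_funM.
    - by apply: measurable_funeM; exact: emeasurable_funD.
    - move=> x Dx.
      rewrite (_ : (a x * b x)%R = ((Q + e) * (N + e) *
         ((a x / (Q + e)) * (b x / (N + e))))%R); last first.
        by field; rewrite !gt_eqF.
      rewrite [leLHS]EFinM; apply: lee_wpmul2l; first by rewrite lee_fin mulr_ge0 ?ltW.
      apply: varphi_young => //; [by case: ep|by case: eq| |].
        by rewrite divr_ge0 ?a0 ?ltW.
      by rewrite divr_ge0 ?b0 ?ltW.
  rewrite ge0_integralZl//; last 3 first.
  - exact: emeasurable_funD.
  - by move=> x _; rewrite adde_ge0// varphi_ge0.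
  - by rewrite lee_fin mulr_ge0 ?ltW.
  rewrite ge0_integralD//; [|by move=> x _; exact: varphi_ge0..].
  rewrite [(2 * _)%R]mulrC [leRHS]EFinM; apply: lee_wpmul2l.
    by rewrite lee_fin mulr_ge0 ?ltW.
  by rewrite (_ : 2%:E = 1 + 1) ?leeD// -EFinD.
apply/lee_addgt0Pr => z z0.
(* For [e <= 1] the bound exceeds [2 * (Q * N)] by at most
   [2 * e * (Q + N + 1)]. *)
pose e : R := Num.min 1%R (z / (2 * (Q + N + 1)))%R.
have C0 : (0 < 2 * (Q + N + 1))%R by rewrite mulr_gt0// ltr_wpDl// addr_ge0.
have e0 : (0 < e)%R by rewrite lt_min ltr01 divr_gt0.
have e1 : (e <= 1)%R by rewrite ge_min lexx.
have ed : (e * (2 * (Q + N + 1)) <= z)%R.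
  by rewrite -ler_pdivlMr// ge_min lexx orbT.
apply: (le_trans (key e e0)); rewrite -EFinD lee_fin.
have ee : (e * e <= e)%R by rewrite ler_piMr// ltW.
nra.
Qed.

(** The form in which the Hoelder inequality is compared with a term of [Sigma].
The norm of [a] may be infinite; then either [S > 0] and the right side is infinite,
or [S = 0] and the right side is 0 by the convention on products, but then [b] is
0 almost everywhere. *)
Lemma hoelder_varexp_bound p q D a b (S : \bar R) : exponent_on p -> exponent_on q ->
  (forall x, (p x)^-1 + (q x)^-1 = 1) -> measurable D ->
  measurable_fun D a ->
  (forall x, D x -> 0 <= a x)%R -> (forall x, D x -> 0 <= b x)%R ->
  measurable_fun D b -> luxemburg p D b < +oo -> luxemburg p D b <= S ->
  \int[mu]_(x in D) (a x * b x)%:E <= 2%:E * (luxemburg q D a * S).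
Proof.
move=> ep eq pq mD ma a0 b0 mb b_lty bS.
have bN : luxemburg p D b = (fine (luxemburg p D b))%:E.
  by rewrite fineK// ge0_fin_numE// luxemburg_ge0.
have S0 : 0 <= S by apply: le_trans bS; exact: luxemburg_ge0.
have [ay|ay] := eqVneq (luxemburg q D a) +oo; last first.
  have aQ : luxemburg q D a = (fine (luxemburg q D a))%:E.
    by rewrite fineK// ge0_fin_numE ?luxemburg_ge0// ltey.
  apply: (le_trans (hoelder_varexp ep eq pq mD ma mb a0 b0 aQ bN)).
  rewrite EFinM; apply: lee_wpmul2l => //.
  rewrite EFinM -aQ -bN; apply: lee_wpmul2l => //; exact: luxemburg_ge0.
have [S00|S00] := eqVneq S 0.
  have b00 : luxemburg p D b = 0.
    by apply/eqP; rewrite eq_le luxemburg_ge0 andbT -S00.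
  rewrite S00 !mule0.
  rewrite (@ae_eq_integral _ _ _ mu D (cst 0)) ?integral0//.
  - by apply/measurable_EFinP; exact: measurable_funM.
  - apply: filterS (luxemburg_eq0_ae ep mD mb b0 b00) => x bx Dx.
    by rewrite bx// mulr0.
by rewrite ay gt0_mulye ?gt0_muley ?leey// lt_neqAle eq_sym S00.
Qed.

End luxemburg.

Section integral_comparison.
Local Open Scope ereal_scope.
Context d (S : measurableType d) (R : realType) (mu : {measure set S -> \bar R}).

(** Integrals of nonnegative functions are suprema over simple functions below them,
so they are monotone for arbitrary functions.  It is applied with [Sigma], of whose
dependence on [x] nothing is known. *)
Lemma ge0_le_integral_nonmeasurable (A : set S) (f1 f2 : S -> \bar R) :
  (forall x, A x -> 0 <= f1 x) -> (forall x, A x -> f1 x <= f2 x) ->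
  \int[mu]_(x in A) f1 x <= \int[mu]_(x in A) f2 x.
Proof.
move=> f10 f12; have f20 x : A x -> 0 <= f2 x.
  by move=> Ax; exact: le_trans (f10 x Ax) (f12 x Ax).
rewrite !ge0_integralE//; apply: ge_ereal_sup => _ [h /= hf1 <-]; apply: ereal_sup_ubound.
exists h => //= x; apply: (le_trans (hf1 x)).
by rewrite !patchE; case: ifPn => // /set_mem; exact: f12.
Qed.

Lemma ge0_integral_setU_le (A B : set S) (f : S -> \bar R) :
  measurable A -> measurable B -> measurable_fun setT f -> (forall x, 0 <= f x) ->
  \int[mu]_(x in A `|` B) f x <= \int[mu]_(x in A) f x + \int[mu]_(x in B) f x.
Proof.
move=> mA mB mf f0; rewrite (_ : A `|` B = A `|` (B `\` A)); last first.
  apply/seteqP; split => x [Ax|Bx]; [by left| |by left|by right; case: Bx].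
  by have [Ax|Ax] := pselect (A x); [left|right].
have mBA : measurable (B `\` A) by exact: measurableD.
rewrite ge0_integral_setU//.
- apply: leeD2l; apply: ge0_subset_integral => //; exact: measurable_funTS.
- exact: measurable_funTS.
- by apply/disj_setPRL => x [].
Qed.

End integral_comparison.

Section Lpnorm_theory.
Context {R : realType}.
Notation LT := (lebesgueType R).

Lemma Lpnorm_lty (r : LT -> \bar R) (A : set LT) (u : LT -> R) : exponent r ->
  measurable A -> (forall v, A v -> 0 <= u v) -> inLp r A u ->
  (Lpnorm r A u < +oo)%E.
Proof.
by move=> er mA u0 [mu_ [lam lam0 ulam]]; exact: (luxemburg_lty er mA u0 mu_ lam0).
Qed.

Lemma Lpnorm_ge0 (r : LT -> \bar R) (A : set LT) (u : LT -> R) : (0 <= Lpnorm r A u)%E.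
Proof. exact: luxemburg_ge0. Qed.

End Lpnorm_theory.

Lemma measurable_Lp_loc (R : realType) (Z : completeNormedModType R[i])
    (p : lebesgueType R -> \bar R) (f : R -> Z) tau :
  transl_diff_Lp_loc p f tau -> measurable_fun setT (transl_diff f tau).
Proof.
move=> H.
rewrite (_ : setT = \bigcup_i (`[- i%:R, i%:R]%classic : set (lebesgueType R))).
  apply/measurable_fun_bigcup => [i|i]; first exact: lebesgue_itv.
  by have [] := H _ (@segment_compact R (- i%:R) i%:R).
apply/seteqP; split => // x _; exists (Num.truncn `|x|).+1 => //=.
by rewrite in_itv/= -ler_norml ltW// truncnS_gt.
Qed.

Section local_Lp.
Context {R : realType}.
Notation LT := (lebesgueType R).
Notation mu := (@lebesgue R).
Variables (p : LT -> \bar R) (ep : exponent p).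

Lemma inLp_union (u : LT -> R) (A B : set LT) (k1 k2 : R) : measurable A -> measurable B ->
  measurable_fun setT u -> (forall x, 0 <= u x) -> 0 < k1 -> 0 < k2 ->
  (modular p A (fun x => k1 * u x)%R < +oo)%E ->
  (modular p B (fun x => k2 * u x)%R < +oo)%E ->
  (modular p (A `|` B) (fun x => Num.min k1 k2 * u x)%R < +oo)%E.
Proof.
move=> mA mB mfu u0 k10 k20 fA fB.
have k0 : 0 < Num.min k1 k2 by rewrite lt_min k10.
have mv : measurable_fun setT (fun x => varphi (p x) (Num.min k1 k2 * u x)).
  apply: (measurable_modular ep); first exact: measurableT.
  exact: measurable_funM.
have vk k (C : set LT) : Num.min k1 k2 <= k ->
    (modular p C (fun x => k * u x)%R < +oo)%E ->
    (modular p C (fun x => Num.min k1 k2 * u x)%R < +oo)%E.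
  move=> kk; apply: le_lt_trans; apply: ge0_le_integral_nonmeasurable.
    by move=> x _; exact: varphi_ge0.
  move=> x _; apply: le_varphi; first exact: (exponent_ge0 x ep).
  by rewrite mulr_ge0 ?(ltW k0)//= ler_wpM2r.
have v0 x : (0 <= varphi (p x) (Num.min k1 k2 * u x))%E by exact: varphi_ge0.
apply: (@le_lt_trans _ _ _ _ _ (ge0_integral_setU_le mu mA mB mv v0)).
apply: lte_add_pinfty.
  by apply: (vk k1) fA; rewrite ge_min lexx.
by apply: (vk k2) fB; rewrite ge_min lexx orbT.
Qed.

(** A compact set is covered by finitely many intervals of length [l]; on a union the
modular is finite for the smaller of the two factors ([inLp_union]). *)
Lemma inLp_compact (u : LT -> R) (l : R) (K : set R) : 0 < l -> compact K ->
  measurable_fun setT u -> (forall x, 0 <= u x) ->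
  (forall t : R, exists2 lam : R, 0 < lam &
     (modular p (`[t, (t + l)%R] : set LT) (fun x => u x / lam)%R <= 1)%E) ->
  inLp p K u.
Proof.
move=> l0 cK mfu u0 H; split; first exact: measurable_funTS.
have [M [Mr HM]] := compact_bounded cK.
pose t0 : R := - (`|M| + 1).
have KM x : K x -> `|x| <= `|M| + 1.
  by apply: HM; rewrite (le_lt_trans (ler_norm _))// ltrDl.
have one (t : R) : exists2 lam : R, 0 < lam &
    (modular p (`[t, (t + l)%R] : set LT) (fun x => lam * u x)%R < +oo)%E.
  have [lam lam0 ul] := H t; exists lam^-1; first by rewrite invr_gt0.
  rewrite (_ : (fun x => _) = (fun x => u x / lam)).
    by apply: (le_lt_trans ul); rewrite ltry.
  by apply/funext => x; rewrite mulrC.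
have many n : exists2 lam : R, 0 < lam &
    (modular p (`[t0, (t0 + n.+1%:R * l)%R] : set LT) (fun x => lam * u x)%R < +oo)%E.
  elim: n => [|n [k1 k10 f1]]; first by rewrite mul1r; exact: one.
  have [k2 k20 f2] := one (t0 + n.+1%:R * l).
  exists (Num.min k1 k2); first by rewrite lt_min k10.
  have nl : 0 <= n.+1%:R * l by rewrite mulr_ge0// ltW.
  rewrite (_ : `[t0, _]%classic = `[t0, t0 + n.+1%:R * l]%classic `|`
      `[t0 + n.+1%:R * l, t0 + n.+1%:R * l + l]%classic); last first.
    have e : t0 + n.+2%:R * l = t0 + n.+1%:R * l + l.
      by rewrite -[n.+2%:R]natr1 mulrDl mul1r addrA.
    rewrite e; apply/seteqP; split => x /=; rewrite !in_itv/=.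
      move=> /andP[x1 x2]; have [x3|x3] := leP x (t0 + n.+1%:R * l).
        by left; rewrite x1.
      by right; rewrite ltW.
    by case=> /andP[x1 x2]; apply/andP; split => //; lra.
  apply: inLp_union => //; exact: lebesgue_itv.
pose n := Num.truncn (2 * (`|M| + 1) / l).
have [lam lam0 fl] := many n; exists lam => //.
apply: le_lt_trans fl; apply: ge0_subset_integral.
- apply: borel_lebesgue; apply: closed_measurable; apply: compact_closed => //.
- exact: lebesgue_itv.
- apply: measurable_funTS; apply: (measurable_modular ep); first exact: measurableT.
  exact: measurable_funM.
- by move=> x _; exact: varphi_ge0.
- move=> x /KM; rewrite ler_norml /= in_itv/= => /andP[x1 x2].
  have M0 : 0 <= 2 * (`|M| + 1) / l by rewrite divr_ge0 ?(ltW l0)// mulr_ge0// addr_ge0.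
  have /andP[_] := truncn_itv M0; rewrite -/n ltr_pdivrMr// => nM.
  by apply/andP; split; rewrite /t0; lra.
Qed.

End local_Lp.

(** * The convolution *)

Section convolution_theory.
Context {R : realType} {X Y : completeNormedModType R[i]}.
Variable T : R -> {linear X -> Y}.
Hypothesis T_bounded : forall t : R, 0 < t -> bounded_near (T t) (nbhs (0 : X)).
Hypothesis T_continuous :
  forall (v : X) (t : R), 0 < t -> {for t, continuous (fun s => T s v)}.
Notation LT := (lebesgueType R).
Notation mu := (@lebesgue R).
Notation D x := (`]- x, +oo[%classic : set LT).
Variable g : R -> X.
Hypothesis g_measurable :
  strongly_measurable mu setT (check g : LT -> X).
Hypothesis g_integrable : forall x : R,
  (\int[mu]_(v in `](- x)%R, +oo[)
     (opnorm (T (v + x)%R) * rnorm (check g v))%:E < +oo)%E.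

Let bochner_mirror (c : R) (A : set LT) (f : LT -> Y) y : measurable A ->
  is_bochner_integral mu A f y ->
  is_bochner_integral mu (mirror c @^-1` A) (f \o mirror c) y.
Proof.
exact: (is_bochner_involution lebesgue_complete (mirrorK c)
  (measurable_fun_mirror c) (fun B _ => lebesgue_mirror c B)).
Qed.

(** The substitution [s = - v]. *)
Lemma convol_unfold x y :
  is_bochner_integral mu (D x) (fun v => T (v + x) (check g v)) y ->
  is_bochner_integral mu (`]-oo, x[ : set LT) (convol_integrand T g x) y.
Proof.
move=> /(@bochner_mirror 0 _ _ _ (lebesgue_itv _)).
rewrite (_ : mirror 0 @^-1` _ = `]-oo, x[%classic); last first.
  by apply/seteqP; split => s; rewrite /preimage/= /mirror !in_itv/= andbT; lra.
congr (is_bochner_integral _ _ _ _); apply/funext => s.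
by rewrite /= /convol_integrand /check /mirror sub0r opprK addrC.
Qed.

(** The substitution [s = - tau - v]. *)
Lemma convol_translate tau x y :
  is_bochner_integral mu (`]-oo, x - tau[ : set LT) (convol_integrand T g (x - tau)) y ->
  is_bochner_integral mu (D x) (fun v => T (v + x) (check g (v + tau))) y.
Proof.
move=> /(@bochner_mirror (- tau) _ _ _ (lebesgue_itv _)).
rewrite (_ : mirror (- tau) @^-1` _ = `]- x, +oo[%classic); last first.
  by apply/seteqP; split => s; rewrite /preimage/= /mirror !in_itv/= andbT; lra.
congr (is_bochner_integral _ _ _ _); apply/funext => v.
rewrite /= /convol_integrand /check /mirror opprD (addrC (- tau)).
by congr (T _ (g _)); lra.
Qed.

Lemma convol_approx : exists2 J : nat -> R -> Y,
  (forall n, exists C : R, forall x x', rnorm (J n x - J n x') <= C * `|x - x'|) &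
  forall x, J n x @[n --> \oo] --> convol T g x /\
    is_bochner_integral mu (D x) (fun v => T (v + x) (check g v)) (convol T g x).
Proof.
have [J [JL Jcvg]] := convolution_lipschitz_approx T_bounded T_continuous
  g_measurable g_integrable.
exists J => // x; have [y Jy by_] := Jcvg x.
rewrite /convol (bochner_integralE lebesgue_complete _ (convol_unfold by_))//.
exact: lebesgue_itv.
Qed.

Lemma is_bochner_convol x :
  is_bochner_integral mu (D x) (fun v => T (v + x) (check g v)) (convol T g x).
Proof. by have [J _ /(_ x)[]] := convol_approx. Qed.

Lemma convol_integrable x :
  bochner_integrable mu (`]-oo, x[ : set LT) (convol_integrand T g x).
Proof. by exists (convol T g x); apply: convol_unfold; exact: is_bochner_convol. Qed.

Lemma measurable_convol_diff tau :
  measurable_fun setT (transl_diff (convol T g) tau).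
Proof.
have [J JL Jcvg] := convol_approx.
apply: (measurable_fun_cvg (h := fun n (x : LT) => rnorm (J n (x + tau) - J n x))).
  move=> n; have [C HC] := JL n.
  apply: measurable_fun_borel => //; apply: continuous_measurable_fun.
  exact: lipschitz_dist_continuous HC.
move=> x _; rewrite /transl_diff; apply: cvg_rnorm; apply: cvgB.
  by have [] := Jcvg (x + tau).
by have [] := Jcvg x.
Qed.

Lemma convol_diff_le tau x :
  measurable_fun setT (transl_diff (check g) tau) ->
  ((transl_diff (convol T g) (- tau) x)%:E <=
   \int[mu]_(v in D x) (opnorm (T (v + x)) * transl_diff (check g) tau v)%:E)%E.
Proof.
move=> mt; rewrite /transl_diff.
apply: (bochner_dist lebesgue_complete (lebesgue_itv _) _ (is_bochner_convol x)).
- apply: (@convol_translate tau); apply: convol_unfold; exact: is_bochner_convol.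
- apply/measurable_EFinP; apply: measurable_funM; first exact: measurable_opnorm.
  exact: measurable_funTS.
- move=> v; rewrite /= in_itv/= andbT => vx; rewrite lee_fin -linearB.
  by apply: opnorm_le; apply: T_bounded; lra.
Qed.

(** [Sigma] integrates over closed intervals, the first of which contains the point
[- x], where [T 0] is arbitrary. *)
Lemma measurable_opnorm_closed (x : R) :
  measurable_fun (`[- x, +oo[ : set LT) (fun v : LT => opnorm (T (v + x))).
Proof.
rewrite (_ : `[- x, +oo[%classic = [set (- x)] `|` `]- x, +oo[%classic); last first.
  apply/seteqP; split => v /=; rewrite !in_itv/= !andbT.
    by rewrite le_eqVlt => /predU1P[->|]; [left|right].
  by case=> [->//|/ltW].
apply/measurable_funU; [| |split]; [| exact: lebesgue_itv | |exact: measurable_opnorm].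
  by rewrite -set_itv1; exact: lebesgue_itv.
exact: measurable_fun_set1.
Qed.

Variables (p q : LT -> \bar R) (phi : R -> R) (F : R -> R -> R).
Hypotheses (ep : exponent p) (eq : exponent q).
Hypothesis pq_conj : forall x, ((p x)^-1 + (q x)^-1 = 1)%E.

Lemma nodeS (l x : R) k : node l x k.+1 = node l x k + l.
Proof. by rewrite /node -natr1 mulrDl mul1r addrA. Qed.

(** The cells are taken half-open to be disjoint and enlarged to the closed ones of
[Sigma] before the Hoelder inequality is applied. *)
Lemma convol_diff_le_Sigma tau l eps x : 0 < l ->
  transl_diff_Lp_loc p (check g) tau ->
  (forall t, phi_preimage phi (eps * (F l t)^-1)
     (fine (Lpnorm p `[t, t + l] (transl_diff (check g) tau)))) ->
  (Sigma T q phi F l eps x < +oo)%E ->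
  0 <= fine (Sigma T q phi F l eps x) /\
  transl_diff (convol T g) (- tau) x <= 2 * fine (Sigma T q phi F l eps x).
Proof.
move=> l0 tLp tpre Sfin.
have mt := measurable_Lp_loc tLp.
pose a (v : LT) := opnorm (T (v + x)).
pose b (v : LT) := transl_diff (check g) tau v.
have a0 v : 0 <= a v by exact: opnorm_ge0.
have b0 v : 0 <= b v by exact: rnorm_ge0.
pose S k := ereal_sup (EFin @` phi_preimage phi (eps * (F l (node l x k))^-1)).
pose C k : set LT := `[node l x k, node l x k.+1]%classic.
pose H k : set LT := `[node l x k, node l x k.+1[%classic.
have bLp k : inLp p (C k) b by exact: tLp (@segment_compact R _ _).
have node_ge k : - x <= node l x k by rewrite /node lerDl mulr_ge0// ltW.
have ma k : measurable_fun (C k) a.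
  apply: (measurable_funS (lebesgue_itv _) _ (@measurable_opnorm_closed x)).
  move=> v; rewrite /C /= !in_itv/= andbT => /andP[+ _]; exact: le_trans.
have b_lty k : (Lpnorm p (C k) b < +oo)%E.
  exact: (Lpnorm_lty ep (lebesgue_itv _) (fun v _ => b0 v) (bLp k)).
have NS k : (Lpnorm p (C k) b <= S k)%E.
  apply: ereal_sup_ubound; exists (fine (Lpnorm p (C k) b)).
    by rewrite /C nodeS; exact: tpre.
  by rewrite fineK// ge0_fin_numE ?Lpnorm_ge0// b_lty.
have S0 k : (0 <= S k)%E by apply: le_trans (NS k); exact: Lpnorm_ge0.
have cell k : (\int[mu]_(v in H k) (a v * b v)%:E <= 2%:E * (Lpnorm q (C k) a * S k))%E.
  apply: (@le_trans _ _ (\int[mu]_(v in C k) (a v * b v)%:E)%E).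
    apply: ge0_subset_integral.
    - exact: lebesgue_itv.
    - exact: lebesgue_itv.
    - apply/measurable_EFinP; apply: measurable_funM => //.
      exact: measurable_funTS.
    - by move=> v _; rewrite lee_fin mulr_ge0.
    - by move=> v; rewrite /H /C /= !in_itv/= => /andP[-> /ltW ->].
  exact: (hoelder_varexp_bound ep eq pq_conj (lebesgue_itv _) (ma k)
    (fun v _ => a0 v) (fun v _ => b0 v) (bLp k).1 (b_lty k) (NS k)).
have mab : measurable_fun (`[- x, +oo[ : set LT) (fun v => (a v * b v)%:E).
  apply/measurable_EFinP; apply: measurable_funM; first exact: measurable_opnorm_closed.
  exact: measurable_funTS.
have UH : \bigcup_k H k = `[- x, +oo[%classic.
  apply/seteqP; split => [v [k _]|v].
    rewrite /H /= !in_itv/= andbT => /andP[+ _]; exact: le_trans.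
  rewrite /= in_itv/= andbT => xv; exists (Num.truncn ((v + x) / l)) => //.
  have v0 : 0 <= (v + x) / l by rewrite divr_ge0 ?(ltW l0)//; lra.
  have /andP[] := truncn_itv v0; rewrite ler_pdivlMr// ltr_pdivrMr// => v1 v2.
  by rewrite /H /= in_itv/= /node; apply/andP; split; lra.
have trivH : trivIset setT H.
  move=> i j _ _ [v []]; rewrite /H /= !in_itv/= /node => /andP[i1 i2] /andP[j1 j2].
  have E k : - x + k%:R * l <= v -> v < - x + k.+1%:R * l ->
      Num.truncn ((v + x) / l) = k.
    move=> k1 k2; apply: truncn_def.
    by rewrite ler_pdivlMr// ltr_pdivrMr//; apply/andP; split; lra.
  by rewrite -(E i)// -(E j).
have SE : Sigma T q phi F l eps x = (\sum_(0 <= k <oo) (Lpnorm q (C k) a * S k))%E by [].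
have term0 k : (0 <= Lpnorm q (C k) a * S k)%E by rewrite mule_ge0// Lpnorm_ge0.
have Sge0 : (0 <= Sigma T q phi F l eps x)%E by rewrite SE; exact: nneseries_ge0.
have Snum : Sigma T q phi F l eps x \is a fin_num by rewrite ge0_fin_numE.
split; first exact: fine_ge0.
rewrite -lee_fin EFinM fineK// (le_trans (convol_diff_le x mt))//.
apply: (@le_trans _ _ (\int[mu]_(v in `[(- x)%R, +oo[) (a v * b v)%:E)%E).
  apply: ge0_subset_integral => //.
  - exact: lebesgue_itv.
  - exact: lebesgue_itv.
  - by move=> v _; rewrite lee_fin; exact: (mulr_ge0 (a0 v) (b0 v)).
  - by move=> v; rewrite /= !in_itv/= !andbT => /ltW.
have mH k : measurable (H k) by exact: lebesgue_itv.
have mabU : measurable_fun (\bigcup_k H k) (fun v => (a v * b v)%:E) by rewrite UH.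
rewrite -UH (ge0_integral_bigcup mu mH mabU _ trivH); last first.
  by move=> v _; rewrite lee_fin; exact: (mulr_ge0 (a0 v) (b0 v)).
rewrite SE -nneseriesZl; last by move=> k _; exact: term0.
apply: lee_nneseries => [k _ _|k _]; last exact: cell.
by apply: integral_ge0 => v _; rewrite lee_fin; exact: (mulr_ge0 (a0 v) (b0 v)).
Qed.

End convolution_theory.

(** * Almost periodicity *)

(** The reflection of an interval exchanges its end points together with their
types. *)
Lemma meets_intervals_opp (R : realType) (L : R) (P P' : set R) :
  (forall tau, P tau -> P' (- tau)) -> meets_intervals L P -> meets_intervals L P'.
Proof.
move=> PP' H a b1 b2.
have [tau tauI /PP' Ptau] := H (- a - L) (~~ b2) (~~ b1).
exists (- tau) => //; move: tauI; rewrite subrK !itv_boundlr/=.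
by case: b1; case: b2; rewrite /= !(bnd_simp, lteBSide)/= => /andP[? ?];
  apply/andP; split; lra.
Qed.

Lemma limf_esup_pinftyP (R : realType) (f : R -> \bar R) (c : R) :
  (limf_esup f (+oo_R) < c%:E)%E ->
  exists M : R, forall l, M < l -> (f l <= c%:E)%E.
Proof.
move=> /ereal_inf_lt[_ [V [M [_ VM]] <-] Vc]; exists M => l /VM Vl.
by apply: (le_trans _ (ltW Vc)); apply: ereal_sup_ubound; exists l.
Qed.

Lemma limf_esup_pinfty_le (R : realType) (f : R -> \bar R) (c : \bar R) (M : R) :
  (forall l, M < l -> (f l <= c)%E) -> (limf_esup f (+oo_R) <= c)%E.
Proof.
move=> fc; apply: ge_ereal_inf.
exists (ereal_sup [set f x | x in [set l | M < l]]).
  by exists [set l | M < l] => //; exists M; split => //; exact: num_real.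
by apply: ge_ereal_sup => _ [l Ml <-]; exact: fc.
Qed.

Section weyl_theory.
Context {R : realType} {X Y : completeNormedModType R[i]}.
Variables (T : R -> {linear X -> Y}) (p q : lebesgueType R -> \bar R).
Variables (phi : R -> R) (F F1 : R -> R -> R) (G : R -> Y).
Hypotheses (ep : exponent p).
Hypothesis F1_gt0 : forall l t : R, 0 < l -> 0 < F1 l t.
Notation LT := (lebesgueType R).

(** Domination by [2 * Sigma] turns the last clause of [star] into a statement about
the translates of [G]. *)
Lemma star_modular tau t l eps :
  (forall x, 0 <= fine (Sigma T q phi F l eps x) /\
    transl_diff G tau x <= 2 * fine (Sigma T q phi F l eps x)) ->
  star T p q phi F F1 t l eps ->
  exists a lam : R, [/\ 0 < lam, lam <= a,
    `[0, a] `<=` phi_preimage phi (eps * (F1 l t)^-1) &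
    (modular p (`[t, (t + l)%R] : set LT) (fun x => transl_diff G tau x / lam)%R <= 1)%E].
Proof.
move=> GS [a [lam [a0 lam0 la sub mod1]]]; exists a, lam; split => //.
apply: le_trans mod1; apply: ge0_le_integral_nonmeasurable.
  by move=> x _; exact: varphi_ge0.
move=> x _; apply: le_varphi; first exact: (exponent_ge0 x ep).
have [S0 GSx] := GS x.
by rewrite divr_ge0 ?rnorm_ge0 ?(ltW lam0)//= ler_wpM2r// invr_ge0 ltW.
Qed.

Lemma star_weyl_sup tau l eps : 0 < l ->
  (forall x, 0 <= fine (Sigma T q phi F l eps x) /\
    transl_diff G tau x <= 2 * fine (Sigma T q phi F l eps x)) ->
  (forall t, star T p q phi F F1 t l eps) ->
  (weyl_sup p phi F1 G tau l <= eps%:E)%E.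
Proof.
move=> l0 GS st; apply: ge_ereal_sup => _ [t _ <-]; rewrite lee_fin.
have [a [lam [lam0 la sub mod1]]] := star_modular GS (st t).
set N := Lpnorm _ _ _.
have Nlam : (N <= lam%:E)%E by exact: (luxemburg_le lam0 mod1).
have N0 : (0 <= N)%E by exact: Lpnorm_ge0.
have Nnum : N \is a fin_num.
  by rewrite ge0_fin_numE// (le_lt_trans Nlam)// ltry.
have : `[0, a]%classic (fine N).
  rewrite /= in_itv/= fine_ge0//= (le_trans _ la)//.
  by rewrite -lee_fin fineK.
by move=> /sub[_ /andP[_]]; rewrite ler_pdivlMr ?F1_gt0// mulrC.
Qed.

Lemma star_Lp_loc tau l eps : 0 < l ->
  measurable_fun setT (transl_diff G tau) ->
  (forall x, 0 <= fine (Sigma T q phi F l eps x) /\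
    transl_diff G tau x <= 2 * fine (Sigma T q phi F l eps x)) ->
  (forall t, star T p q phi F F1 t l eps) ->
  transl_diff_Lp_loc p G tau.
Proof.
move=> l0 mG GS st K cK; apply: (inLp_compact ep l0 cK mG).
  by move=> x; exact: rnorm_ge0.
move=> t; have [a [lam [lam0 _ _ mod1]]] := star_modular GS (st t).
by exists lam.
Qed.

Lemma weyl_sup_phi_preimage (Z : completeNormedModType R[i]) (f : R -> Z) tau l eps :
  (forall s : R, 0 <= s -> 0 <= phi s) -> (forall t, 0 < F l t) ->
  (weyl_sup p phi F f tau l <= eps%:E)%E -> forall t,
  phi_preimage phi (eps * (F l t)^-1)
    (fine (Lpnorm p `[t, t + l] (transl_diff f tau))).
Proof.
move=> phi0 F0 ws t; set N := fine _.
have N0 : 0 <= N by apply: fine_ge0; exact: Lpnorm_ge0.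
split => //; rewrite phi0//= ler_pdivlMr// mulrC -lee_fin.
by apply: le_trans ws; apply: ereal_sup_ubound; exists t.
Qed.

End weyl_theory.

Theorem theorem4p6 (R : realType) (X Y : completeNormedModType R[i])
  (phi : R -> R) (F F1 : R -> R -> R) (p q : lebesgueType R -> \bar R)
  (T : R -> {linear X -> Y}) (g : R -> X)
  (phi_ge0 : forall s : R, 0 <= s -> 0 <= phi s)
  (F_gt0 : forall l t : R, 0 < l -> 0 < F l t)
  (F1_gt0 : forall l t : R, 0 < l -> 0 < F1 l t)
  (p_exponent : exponent p) (q_exponent : exponent q)
  (pq_conj : forall x, ((p x)^-1 + (q x)^-1 = 1)%E)
  (T_bounded : forall t : R, 0 < t -> bounded_near (T t) (nbhs (0 : X)))
  (T_strongly_continuous :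
     forall (v : X) (t : R), 0 < t -> {for t, continuous (fun s => T s v)})
  (g_measurable :
     strongly_measurable (@lebesgue R) setT (check g : lebesgueType R -> X))
  (g_integrable : forall x : R,
     (\int[@lebesgue R]_(v in `](- x)%R, +oo[)
        (opnorm (T (v + x)%R) * rnorm (check g v))%:E < +oo)%E)
  (Sigma_fin : forall l eps x : R, 0 < l -> 0 < eps ->
     (Sigma T q phi F l eps x < +oo)%E)
  (g_Lp_loc : forall tau : R, transl_diff_Lp_loc p (check g) tau) :
  (equi_weyl_ap p phi F (check g) ->
   (forall t l eps : R, 0 < l -> 0 < eps -> star T p q phi F F1 t l eps) ->
   (forall x : R, bochner_integrable (@lebesgue R) `]-oo, x[ (convol_integrand T g x))
   /\ equi_weyl_ap p phi F1 (convol T g))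
  /\
  (weyl_ap p phi F (check g) ->
   (exists2 l0 : R, 0 < l0 & forall t l eps : R, l0 <= l -> 0 < eps ->
      star T p q phi F F1 t l eps) ->
   (forall x : R, bochner_integrable (@lebesgue R) `]-oo, x[ (convol_integrand T g x))
   /\ weyl_ap p phi F1 (convol T g)).
Proof.
have G_def x := convol_integrable T_bounded T_strongly_continuous g_measurable
  g_integrable x.
have mG tau := measurable_convol_diff T_bounded T_strongly_continuous g_measurable
  g_integrable tau.
have GS tau l eps : 0 < l -> 0 < eps ->
    (weyl_sup p phi F (check g) tau l <= eps%:E)%E -> forall x,
    0 <= fine (Sigma T q phi F l eps x) /\
    transl_diff (convol T g) (- tau) x <= 2 * fine (Sigma T q phi F l eps x).
  move=> l0 eps0 ws x.
  apply: (convol_diff_le_Sigma T_bounded T_strongly_continuous g_measurable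
    g_integrable p_exponent q_exponent pq_conj l0 (g_Lp_loc tau)); last exact: Sigma_fin.
  by apply: weyl_sup_phi_preimage => // t; exact: F_gt0.
split=> [g_ap st|g_ap [l0 l00 st]]; (split; first exact: G_def); move=> eps eps0.
  have [l [L [l0 L0 meets]]] := g_ap eps eps0.
  exists l, L; split; [exact: l0|exact: L0|].
  apply: meets_intervals_opp meets => tau [_ ws].
  have GSt := GS tau l eps l0 eps0 ws; split.
    by apply: (star_Lp_loc p_exponent l0 (mG _) GSt) => t; exact: st.
  by apply: (star_weyl_sup p_exponent F1_gt0 l0 GSt) => t; exact: st.
have eps20 : 0 < eps / 2 by rewrite divr_gt0.
have [L L0 meets] := g_ap (eps / 2) eps20; exists L => //.
apply: meets_intervals_opp meets => tau [_ ws].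
have [M HM] : exists M : R, forall l, M < l ->
    (weyl_sup p phi F (check g) tau l <= eps%:E)%E.
  apply: limf_esup_pinftyP; apply: le_lt_trans ws _.
  by rewrite lte_fin ltr_pdivrMr// ltr_pMr// ltrDl.
pose M' := Num.max M l0.
have M'0 l : M' < l -> [/\ 0 < l, M < l & l0 <= l].
  by rewrite gt_max => /andP[Ml l0l]; split => //; [exact: lt_trans l0l|exact: ltW].
split.
  have [|l1 Ml l0l] := M'0 (M' + 1); first by rewrite ltrDl.
  apply: (star_Lp_loc p_exponent l1 (mG _) (GS tau _ eps l1 eps0 (HM _ Ml))) => t.
  exact: st.
apply: (@limf_esup_pinfty_le _ _ _ M') => l /M'0[l1 Ml l0l].
apply: (star_weyl_sup p_exponent F1_gt0 l1 (GS tau l eps l1 eps0 (HM l Ml))) => t.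
exact: st.
Qed.
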